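(* Let $\Gamma$ be a finite simplicial graph which is connected and anti-connected, and let $H<A(\Gamma)$ be a finitely generated star-free subgroup. Then: (1) $H$ is a free group; (2) $H$ is undistorted in $A(\Gamma)$, i.e. the inclusion $H\to A(\Gamma)$ is a quasi-isometric embedding with respect to word metrics from finite generating sets; (3) for every induced subgraph $\Lambda\subset\Gamma$, the group $H_\Lambda = H\cap A(\Lambda)$ is finitely generated.
   Context: $A(\Gamma)$ is the right-angled Artin group with generators $V(\Gamma)$ and relations $[v,w]=1$ for $\{v,w\}\in E(\Gamma)$. For an induced subgraph $\Lambda$, $A(\Lambda)$ is identified with the subgroup of $A(\Gamma)$ generated by $V(\Lambda)$. A graph is anti-connected if its opposite (complement) graph is connected. The star $\mathrm{St}(v)$ of a vertex $v$ consists of $v$ and all vertices adjacent to $v$; a star subgroup is $A(\mathrm{St}(v))$ for some $v\in V(\Gamma)$. A subgroup $H<A(\Gamma)$ is star-free if no nontrivial element of $H$ is conjugate in $A(\Gamma)$ into a star subgroup. *)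

(* Defs.v *)
From HB Require Import structures.
From mathcomp Require Import all_boot all_order ssralg ssrnum.
From mathcomp Require Import boolp classical_sets reals.

Set Implicit Arguments.
Unset Strict Implicit.
Unset Printing Implicit Defensive.

Local Open Scope quotient_scope.

(* Convention: the letter (x, true) stands for the generator x, and (x, false)
   for its inverse. *)
Definition word (S : Type) : Type := seq (S * bool).

Section Presentation.
Variables (S : choiceType) (R : word S -> Prop).
Implicit Types u v w : word S.

(* Equality in the group with presentation < S | R >. *)
Inductive pres_eq : word S -> word S -> Prop :=
  | pres_refl u : pres_eq u u
  | pres_sym u v : pres_eq u v -> pres_eq v u
  | pres_trans v u w : pres_eq u v -> pres_eq v w -> pres_eq u w
  | pres_cancel u v x b : pres_eq (u ++ [:: (x, b); (x, ~~ b)] ++ v) (u ++ v)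
  | pres_relator u v r : R r -> pres_eq (u ++ r ++ v) (u ++ v).

Definition pres_eqb : rel (word S) := fun u v => `[< pres_eq u v >].

Lemma pres_eqb_refl : reflexive pres_eqb.
Proof. by move=> u; apply/asboolP; exact: pres_refl. Qed.

Lemma pres_eqb_sym : symmetric pres_eqb.
Proof. by move=> u v; apply/asboolP/asboolP => /pres_sym. Qed.

Lemma pres_eqb_trans : transitive pres_eqb.
Proof.
by move=> v u w /asboolP uv /asboolP vw; apply/asboolP; exact: pres_trans uv vw.
Qed.

Canonical pres_equiv : equiv_rel (word S) :=
  EquivRel pres_eqb pres_eqb_refl pres_eqb_sym pres_eqb_trans.

Definition pres_group : Type := {eq_quot pres_equiv}.
HB.instance Definition _ := Choice.on pres_group.

Definition pres_class u : pres_group := \pi_({eq_quot pres_equiv})%qT u.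

Definition pres_gen (x : S) : pres_group := pres_class [:: (x, true)].

Definition inv_word u : word S := rev [seq (a.1, ~~ a.2) | a <- u].

Lemma pres_classP u v : pres_class u = pres_class v <-> pres_eq u v.
Proof. by split=> [/eqmodP/asboolP|uv]; last exact/eqmodP/asboolP. Qed.

Lemma pres_class_surj (g : pres_group) : exists u, g = pres_class u.
Proof. by exists (repr (g : {eq_quot pres_equiv})); rewrite /pres_class reprK. Qed.

Lemma pres_eq_ctx a b u v : pres_eq u v -> pres_eq (a ++ u ++ b) (a ++ v ++ b).
Proof.
elim=> {u v} [u|u v _ IH|v u w _ IHu _ IHv|u v x c|u v r Rr].
- exact: pres_refl.
- exact: pres_sym.
- exact: pres_trans IHu IHv.
- have := pres_cancel (a ++ u) (v ++ b) x c.
  by rewrite -!catA.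
- have := pres_relator (a ++ u) (v ++ b) Rr.
  by rewrite -!catA.
Qed.

Lemma pres_eq_cat u u' v v' :
  pres_eq u u' -> pres_eq v v' -> pres_eq (u ++ v) (u' ++ v').
Proof.
move=> uu' vv'; apply: (@pres_trans (u' ++ v)).
  exact: (pres_eq_ctx [::] v uu').
by have := pres_eq_ctx u' [::] vv'; rewrite !cats0.
Qed.

Lemma inv_word_cat u v : inv_word (u ++ v) = inv_word v ++ inv_word u.
Proof. by rewrite /inv_word map_cat rev_cat. Qed.

Lemma inv_wordK : involutive inv_word.
Proof.
move=> u; rewrite /inv_word map_rev revK -map_comp -[RHS]map_id.
by apply: eq_map => -[x b] /=; rewrite negbK.
Qed.

Lemma pres_eq_mulVw u : pres_eq (inv_word u ++ u) [::].
Proof.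
elim: u => [|[x b] u IH]; first exact: pres_refl.
have -> : (x, b) :: u = [:: (x, b)] ++ u by [].
rewrite inv_word_cat -catA /= /inv_word /=.
have := pres_cancel (inv_word u) u x (~~ b); rewrite negbK => h.
exact: pres_trans h IH.
Qed.

Lemma pres_eq_mulwV u : pres_eq (u ++ inv_word u) [::].
Proof. by have := pres_eq_mulVw (inv_word u); rewrite inv_wordK. Qed.

Lemma pres_eq_inv u v : pres_eq u v -> pres_eq (inv_word u) (inv_word v).
Proof.
move=> uv; apply: (@pres_trans (inv_word u ++ v ++ inv_word v)).
  have := pres_eq_cat (pres_refl (inv_word u)) (pres_eq_mulwV v).
  by rewrite cats0 => /pres_sym.
apply: (@pres_trans (inv_word u ++ u ++ inv_word v)).
  exact/pres_eq_ctx/pres_sym.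
rewrite catA.
exact: (pres_eq_cat (pres_eq_mulVw u) (pres_refl (inv_word v))).
Qed.

Definition pres_one : pres_group := pres_class [::].

Definition pres_mul (g h : pres_group) : pres_group :=
  pres_class (repr (g : {eq_quot pres_equiv}) ++ repr (h : {eq_quot pres_equiv})).

Definition pres_inv (g : pres_group) : pres_group :=
  pres_class (inv_word (repr (g : {eq_quot pres_equiv}))).

Lemma pres_repr u : pres_eq (repr (pres_class u : {eq_quot pres_equiv})) u.
Proof. by apply/pres_classP; rewrite /pres_class reprK. Qed.

Lemma pres_mulE u v : pres_mul (pres_class u) (pres_class v) = pres_class (u ++ v).
Proof. by apply/pres_classP/pres_eq_cat; exact: pres_repr. Qed.

Lemma pres_invE u : pres_inv (pres_class u) = pres_class (inv_word u).
Proof. by apply/pres_classP/pres_eq_inv; exact: pres_repr. Qed.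

Lemma pres_mulA : associative pres_mul.
Proof.
move=> g h k; have [u ->] := pres_class_surj g; have [v ->] := pres_class_surj h.
by have [w ->] := pres_class_surj k; rewrite !pres_mulE catA.
Qed.

Lemma pres_mul1g : left_id pres_one pres_mul.
Proof. by move=> g; have [u ->] := pres_class_surj g; rewrite pres_mulE. Qed.

Lemma pres_mulg1 : right_id pres_one pres_mul.
Proof. by move=> g; have [u ->] := pres_class_surj g; rewrite pres_mulE cats0. Qed.

Lemma pres_mulVg : left_inverse pres_one pres_inv pres_mul.
Proof.
move=> g; have [u ->] := pres_class_surj g; rewrite pres_invE pres_mulE.
exact/pres_classP/pres_eq_mulVw.
Qed.

Lemma pres_mulgV : right_inverse pres_one pres_inv pres_mul.
Proof.
move=> g; have [u ->] := pres_class_surj g; rewrite pres_invE pres_mulE.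
exact/pres_classP/pres_eq_mulwV.
Qed.

HB.instance Definition _ := isGroup.Build pres_group
  pres_mulA pres_mul1g pres_mulg1 pres_mulVg pres_mulgV.

End Presentation.

Definition free_group (S : choiceType) : groupType :=
  pres_group (fun _ : word S => False).

Local Open Scope classical_set_scope.
Local Open Scope group_scope.

Section GroupNotions.
Variable G : groupType.
Implicit Types (H : set G) (s t : seq G) (g h : G).

Definition subgroup H : Prop := group_closed [in H].

Definition gen_subgroup (X : set G) : set G := smallest subgroup X.

Definition generates s H : Prop := gen_subgroup [set` s] = H.

Definition fin_gen H : Prop := exists s, generates s H.

Definition is_free H : Prop :=
  exists (S : choiceType) (f : free_group S -> G),
    [/\ monoid_morphism f, injective f & range f = H].

Definition expressible s g (n : nat) : Prop :=
  exists w : seq G, [/\ size w = n,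
    all (fun x => (x \in s) || (x^-1 \in s)) w & \prod_(x <- w) x = g].

(* Junk value 0 when g is not in the subgroup generated by s. *)
Definition word_length s g : nat :=
  if pselect (exists n, `[< expressible s g n >]) is left ex
  then ex_minn ex else 0.

Definition word_dist (R : realType) s g h : R :=
  ((word_length s (g^-1 * h))%:R)%R.

(* To be used for finitely generated H in a finitely generated G. *)
Definition undistorted (R : realType) H : Prop :=
  forall s t, generates s [set: G] -> generates t H ->
  exists K C : R, [/\ (1 <= K)%R, (0 <= C)%R &
    forall g h, H g -> H h ->
      (K^-1 * word_dist R t g h - C <= word_dist R s g h)%R /\
      (word_dist R s g h <= K * word_dist R t g h + C)%R].

End GroupNotions.

Section RAAG.
Variables (V : finType) (e : rel V).

Definition simple_graph : Prop := symmetric e /\ irreflexive e.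

Definition opposite : rel V := fun x y => (x != y) && ~~ e x y.

Definition connected_graph (r : rel V) : Prop := forall x y, connect r x y.

Definition star (v : V) : {set V} := [set w | (w == v) || e v w]%SET.

Definition raag_relator (r : word V) : Prop :=
  exists v w, e v w /\
    r = [:: (v, false); (w, false); (v, true); (w, true)].

Definition raag : groupType := pres_group raag_relator.

Definition raag_gen (v : V) : raag := pres_gen raag_relator v.

(* The induced subgraph on L is given by its vertex set. *)
Definition raag_sub (L : {set V}) : set raag :=
  gen_subgroup [set raag_gen v | v in [set` L]].

Definition star_free (H : set raag) : Prop :=
  forall h v g, H h -> raag_sub (star v) (h ^ g) -> h = 1.

End RAAG.

(* Main.v *)
Require Import Defs.
From mathcomp Require Import all_boot order ssralg ssrnum.
From mathcomp Require Import boolp classical_sets reals.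
From mathcomp Require Import zify.

(* Order the vertices by an injective rank r, and call [lower x] the set of
   neighbours of x of smaller rank. Since H is star-free, it acts freely on the
   cosets g A(lower x), so one can choose, H-equivariantly, one element in each
   of these cosets, for every x. The edges (g, g x) of the Cayley graph starting
   at the chosen elements form an H-invariant spanning tree: connectedness is an
   induction on the rank, and a reduced loop would have to cross some wall
   g A(link x) of maximal rank x twice, hence the same edge twice. Vertices of
   rank < n span subtrees, so every A(L) is a subtree for a suitable rank.
   (1) H acts freely on a tree, hence is free.
   (3) The H-orbit of 1 spans a subtree with finite quotient, in which the part
   lying in A(L) embeds modulo H_L, so H_L is finitely generated.
   (2) In that subtree, two edges of a reduced path that cross the same wall are
   at bounded distance N. A subpath with letters of rank <= n that is long
   compared with N then has, away from its ends, either an edge of rank n,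
   whose wall cannot be crossed a second time, or a long subpath of rank < n.
   So a positive proportion of the edges of a tree path have walls crossed only
   once by the path, and every word representing the same element must cross
   these walls. *)

Set Implicit Arguments.
Unset Strict Implicit.
Unset Printing Implicit Defensive.

Local Open Scope classical_set_scope.
Local Open Scope group_scope.

Ltac gsimp :=
  rewrite ?(invgM, invgK, invg1, mulgA, mul1g, mulg1, mulVg, mulgV, mulgK, mulgVK).

(** * Subgroups *)

Section Subgroups.
Variable G : groupType.
Implicit Types (H : set G) (X : set G) (s t : seq G) (g h x : G).

Lemma subgroup1 H : subgroup H -> H 1.
Proof. by case=> /set_mem. Qed.

Lemma subgroupM H g h : subgroup H -> H g -> H h -> H (g * h).
Proof.
move=> /group_closedM sH Hg Hh.
by have /set_mem := sH g h (mem_set Hg) (mem_set Hh).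
Qed.

Lemma subgroupV H g : subgroup H -> H g -> H g^-1.
Proof. by move=> /group_closedV sH Hg; have /set_mem := sH g (mem_set Hg). Qed.

Lemma subgroupMl H g h : subgroup H -> H g -> H (g * h) <-> H h.
Proof.
move=> sH Hg; split=> [Hgh|]; last exact: subgroupM.
by rewrite -[h](mulKg g); apply: subgroupM => //; apply: subgroupV.
Qed.

Lemma subgroup_closed H :
  H 1 -> (forall g h, H g -> H h -> H (g * h)) ->
  (forall g, H g -> H g^-1) -> subgroup H.
Proof.
move=> H1 HM HV; split; first exact/mem_set.
by move=> g h /set_mem Hg /set_mem Hh; apply/mem_set/HM => //; apply: HV.
Qed.

Lemma subgroupI H K : subgroup H -> subgroup K -> subgroup (H `&` K).
Proof.
move=> sH sK; apply: subgroup_closed.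
- by split; apply: subgroup1.
- by move=> g h [? ?] [? ?]; split; apply: subgroupM.
- by move=> g [? ?]; split; apply: subgroupV.
Qed.

Lemma gen_subgroup_sub X H : subgroup H -> X `<=` H -> gen_subgroup X `<=` H.
Proof. by move=> sH XH; apply: smallest_sub. Qed.

Lemma sub_gen_subgroup X : X `<=` gen_subgroup X.
Proof. exact: sub_smallest. Qed.

Lemma gen_subgroup_subgroup X : subgroup (gen_subgroup X).
Proof.
apply: subgroup_closed.
- by move=> K [/subgroup1].
- by move=> g h Xg Xh K [sK XK]; apply: subgroupM => //; [apply: Xg|apply: Xh].
- by move=> g Xg K [sK XK]; apply: subgroupV => //; apply: Xg.
Qed.

End Subgroups.

(** * Words in right-angled Artin groups *)

Section Words.
Variables (V : finType) (e : rel V).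
Local Notation G := (raag e).
Local Notation letter := (V * bool)%type.
Implicit Types (u v w : word V) (a b : letter) (x y : V) (g h : G).

Definition ev w : G := pres_class (raag_relator e) w.

Lemma ev_cat u v : ev (u ++ v) = ev u * ev v.
Proof. by rewrite /ev -pres_mulE. Qed.

Lemma ev_nil : ev [::] = 1.
Proof. by []. Qed.

Lemma ev_cons a w : ev (a :: w) = ev [:: a] * ev w.
Proof. exact: (ev_cat [:: a]). Qed.

Lemma ev_rcons w a : ev (rcons w a) = ev w * ev [:: a].
Proof. by rewrite -cats1 ev_cat. Qed.

Lemma ev_inv w : ev (inv_word w) = (ev w)^-1.
Proof. by rewrite /ev -pres_invE. Qed.

Lemma ev_surj g : exists w, g = ev w.
Proof. exact: pres_class_surj. Qed.

Definition linv a : letter := (a.1, ~~ a.2).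

Lemma linvK : involutive linv.
Proof. by case=> x b; rewrite /linv negbK. Qed.

Lemma ev_linv a : ev [:: linv a] = (ev [:: a])^-1.
Proof. by rewrite -ev_inv. Qed.

Lemma raag_subP (L : {set V}) g :
  raag_sub L g <-> exists2 w, all (fun a => a.1 \in L) w & ev w = g.
Proof.
split.
  pose P g := exists2 w, all (fun a => a.1 \in L) w & ev w = g.
  move: g; apply: (@gen_subgroup_sub _ _ P).
    apply: subgroup_closed; first by exists [::].
    - by move=> _ _ [u Lu <-] [v Lv <-]; exists (u ++ v); rewrite ?all_cat ?Lu // ev_cat.
    - move=> _ [u Lu <-]; exists (inv_word u); last by rewrite ev_inv.
      by rewrite /inv_word all_rev all_map.
  by move=> _ [x Lx <-]; exists [:: (x, true)] => //=; rewrite andbT.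
case=> w + <-; have sL := gen_subgroup_subgroup [set raag_gen e v | v in [set` L]].
elim: w => [_|[x b] w IH] /=; first exact: (subgroup1 sL).
case/andP=> Lx Lw; rewrite ev_cons; apply: (subgroupM sL) => //; last exact: IH.
have Lgen : raag_sub L (ev [:: (x, true)]) by apply: sub_gen_subgroup; exists x.
by case: b => //; rewrite (ev_linv (x, true)); apply: (subgroupV sL).
Qed.

Lemma raag_sub_subgroup (L : {set V}) : subgroup (raag_sub (e := e) L).
Proof. exact: gen_subgroup_subgroup. Qed.

Lemma raag_subS (L M : {set V}) : L \subset M -> raag_sub (e := e) L `<=` raag_sub M.
Proof.
move=> /fintype.subsetP LM g /raag_subP[w Lw <-]; apply/raag_subP; exists w => //.
by apply: sub_all Lw => a /LM.
Qed.

(* Deleting the letters outside M defines a retraction onto A(M). *)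
Lemma pres_eq_filter (M : {set V}) u v :
  pres_eq (raag_relator e) u v ->
  pres_eq (raag_relator e) [seq a <- u | a.1 \in M] [seq a <- v | a.1 \in M].
Proof.
elim=> {u v} [u|u v _ IH|v u w _ IHu _ IHv|u v x b|u v r [x [y [exy ->]]]].
- exact: pres_refl.
- exact: pres_sym.
- exact: pres_trans IHu IHv.
- rewrite !filter_cat /=; case: (x \in M) => /=; last exact: pres_refl.
  exact: (pres_cancel _ [seq a <- u | a.1 \in M] [seq a <- v | a.1 \in M]).
rewrite !filter_cat /=.
set u' := [seq a <- u | _]; set v' := [seq a <- v | _].
case: (x \in M); case: (y \in M) => /=.
- have : raag_relator e [:: (x, false); (y, false); (x, true); (y, true)].
    by exists x, y.
  exact: (pres_relator u' v').
- exact: (pres_cancel _ u' v' x false).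
- exact: (pres_cancel _ u' v' y false).
- exact: pres_refl.
Qed.

(** The retraction onto [A(M)] fixes [g]; applied to a spelling of [g] over [L], it leaves only
    letters lying in both [L] and [M]. *)
Lemma raag_subI (L M : {set V}) g :
  raag_sub L g -> raag_sub M g -> raag_sub (L :&: M) g.
Proof.
move=> /raag_subP[u Lu ug] /raag_subP[v Mv vg]; apply/raag_subP.
exists [seq a <- u | a.1 \in M].
  apply/allP=> a; rewrite mem_filter finset.inE => /andP[-> au].
  by rewrite andbT (allP Lu).
rewrite -vg -[in RHS](all_filterP Mv); apply/pres_classP/pres_eq_filter.
by apply/pres_classP; rewrite -/(ev u) -/(ev v) ug.
Qed.

End Words.

(** * Walks in the Cayley graph and wall crossings *)

Section Walks.
Variables (V : finType) (e : rel V).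
Local Notation G := (raag e).
Local Notation letter := (V * bool)%type.
Local Notation ev := (@ev V e).
Implicit Types (u v w : word V) (a b : letter) (x y : V) (g h p q : G).
Implicit Types Q : G -> letter -> Prop.

(** [Q g a] is a condition on the edge leaving [g] with label [a]. It stays abstract so as to cover
    tree edges, tree edges within finitely many [H]-orbits, and plain conditions on labels. *)
Fixpoint walk Q g w : Prop :=
  if w is a :: w' then Q g a /\ walk Q (g * ev [:: a]) w' else True.

Lemma walk_cat Q g u v : walk Q g (u ++ v) <-> walk Q g u /\ walk Q (g * ev u) v.
Proof.
elim: u g => [|a u IH] g /=; first by rewrite ev_nil mulg1; split=> // -[].
by rewrite (ev_cons e a u) mulgA IH; tauto.
Qed.

Lemma walk_sub Q Q' g w :
  (forall g a, Q g a -> Q' g a) -> walk Q g w -> walk Q' g w.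
Proof. by move=> QQ'; elim: w g => //= a w IH g [/QQ' ? /IH]. Qed.

Lemma walk_all Q g w (A : pred letter) :
  (forall g a, Q g a -> A a) -> walk Q g w -> all A w.
Proof. by move=> QA; elim: w g => //= a w IH g [/QA -> /IH]. Qed.

Lemma all_walk g w (A : pred letter) : all A w -> walk (fun _ a => A a) g w.
Proof. by elim: w g => //= a w IH g /andP[-> /IH]. Qed.

Lemma walk_trans Q Q' k g w : (forall g a, Q g a -> Q' (k * g) a) ->
  walk Q g w -> walk Q' (k * g) w.
Proof.
by move=> QQ'; elim: w g => //= a w IH g [/QQ' ? /IH]; rewrite mulgA.
Qed.

Lemma walk_inv Q g w :
  (forall g a, Q g a -> Q (g * ev [:: a]) (linv a)) ->
  walk Q g w -> walk Q (g * ev w) (inv_word w).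
Proof.
move=> Qsym; elim: w g => //= a w IH g [Qa Qw].
rewrite -[a :: w]/([:: a] ++ w) inv_word_cat walk_cat ev_cat mulgA; split.
  exact: IH.
by rewrite ev_inv; gsimp; split=> //; apply: Qsym.
Qed.

(** Only backtracking is excluded; commutations are ignored. This is reducedness of an edge path,
    not of a word in the Artin group. *)
Definition reduced w : bool := sorted (fun a b => b != linv a) w.

Lemma reduced_catl u v : reduced (u ++ v) -> reduced u.
Proof. by case/cat_sorted2. Qed.

Lemma reduced_catr u v : reduced (u ++ v) -> reduced v.
Proof. by case/cat_sorted2. Qed.

Lemma reduced_inv w : reduced w -> reduced (inv_word w).
Proof.
rewrite /reduced /inv_word rev_sorted sorted_map.
by apply: sub_sorted => -[x b] [y c]; rewrite /linv /= negbK eq_sym.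
Qed.

Lemma reduced_cons_cat u a v :
  reduced (rcons u a) -> reduced (a :: v) -> reduced (u ++ a :: v).
Proof.
rewrite /reduced; case: u => [//|b u] /=.
by rewrite cat_path rcons_path /= => /andP[-> ->] ->.
Qed.

Lemma reduced_rcons2 w b a :
  reduced (rcons (rcons w b) a) = reduced (rcons w b) && (a != linv b).
Proof.
rewrite /reduced; case: w => [|c w] /=; first by rewrite andbT.
by rewrite rcons_path last_rcons.
Qed.

Fixpoint reduce w : word V :=
  if w is a :: w' then
    if reduce w' is b :: w'' then
      if b == linv a then w'' else a :: b :: w''
    else [:: a]
  else [::].

Lemma reduce_reduced w : reduced (reduce w).
Proof.
elim: w => //= a w; case: (reduce w) => [|b w'] //= rw.
case: eqP => [_|/eqP ba]; last by rewrite /reduced /= ba.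
by move: rw; apply: (@reduced_catr [:: b]).
Qed.

Lemma ev_reduce w : ev (reduce w) = ev w.
Proof.
elim: w => //= a w; rewrite (ev_cons e a w) => <-.
case: (reduce w) => [|b w']; first by rewrite ev_nil mulg1.
case: eqP => [->|_]; last by rewrite ev_cons.
by rewrite (ev_cons e (linv a)) ev_linv mulgA mulgV mul1g.
Qed.

Lemma walk_reduce Q g w : walk Q g w -> walk Q g (reduce w).
Proof.
elim: w g => //= a w IH g [Qa /IH]; case: (reduce w) => [|b w'] //=.
case: eqP => [-> [_]|_ //]; by rewrite ev_linv mulgK.
Qed.

(** The tail of the edge once it is oriented along its positive generator. An edge and its reverse
    thus have the same [org], which together with the vertex [a.1] names the unoriented edge. *)
Definition org g a : G := if a.2 then g else g * ev [:: a].

Lemma orgM k g a : org (k * g) a = k * org g a.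
Proof. by rewrite /org; case: ifP => // _; rewrite mulgA. Qed.

Lemma org_linv g a : org (g * ev [:: a]) (linv a) = org g a.
Proof. by case: a => x [] /=; rewrite /org //= (ev_linv e (x, true)) mulgK. Qed.

Definition link x : {set V} := [set y | e x y]%SET.

Lemma link_commute x (b : bool) g :
  raag_sub (link x) g -> commute g (ev [:: (x, b)]).
Proof.
move=> xg; apply: commute_sym; pose P : set G := commute (ev [:: (x, b)]).
apply: (gen_subgroup_sub (H := P) _ _ xg).
  apply: subgroup_closed; first exact: commute1.
  - by move=> *; apply: commuteM.
  - by move=> *; apply: commuteV.
move=> _ [y /= + <-]; rewrite finset.inE => exy; rewrite /P /=.
suff xy : commute (ev [:: (x, true)]) (ev [:: (y, true)]).
  case: (b) => //; rewrite (ev_linv e (x, true)).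
  by apply/commute_sym/commuteV/commute_sym.
have : raag_relator e [:: (x, false); (y, false); (x, true); (y, true)].
  by exists x, y.
move/(pres_relator [::] [::])/pres_classP; rewrite -!/(ev _) /= ev_nil.
rewrite (ev_cons e (x, false)) (ev_cons e (y, false)) (ev_cons e (x, true)).
rewrite (ev_linv e (x, true)) (ev_linv e (y, true)) => xy1.
by apply/commgP; rewrite commgEl conjgE xy1.
Qed.

(* The vertices p and q lie in the same coset of A(link x), that is, the
   edges (p, p x) and (q, q x) cross the same hyperplane. *)
Definition same_wall x q p : Prop := raag_sub (link x) (q^-1 * p).

Lemma same_wall_refl x q : same_wall x q q.
Proof. by rewrite /same_wall mulVg; apply: (subgroup1 (raag_sub_subgroup _ _)). Qed.

Lemma same_wall_sym x q p : same_wall x q p -> same_wall x p q.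
Proof.
by rewrite /same_wall => /(subgroupV (raag_sub_subgroup _ _)); gsimp.
Qed.

Lemma same_wall_trans x q p p' :
  same_wall x q p -> same_wall x p p' -> same_wall x q p'.
Proof.
rewrite /same_wall => h1 h2.
by have := subgroupM (raag_sub_subgroup _ _) h1 h2; gsimp.
Qed.

Lemma same_wallM k x q p : same_wall x (k * q) (k * p) <-> same_wall x q p.
Proof. by rewrite /same_wall; gsimp. Qed.

(** Number modulo 2 of crossings, by the walk from [g], of the wall of the edge from [q] labelled
    [x]. *)
Fixpoint parity x q g w : bool :=
  if w is a :: w' then
    ((a.1 == x) && `[< same_wall x q (org g a) >]) (+) parity x q (g * ev [:: a]) w'
  else false.

Lemma parity_cat x q g u v :
  parity x q g (u ++ v) = parity x q g u (+) parity x q (g * ev u) v.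
Proof.
elim: u g => [|a u IH] g /=; first by rewrite ev_nil mulg1.
by rewrite IH (ev_cons e a u) mulgA addbA.
Qed.

Lemma same_wall_link x y (c : bool) q p :
  e x y -> `[< same_wall x q (p * ev [:: (y, c)]) >] = `[< same_wall x q p >].
Proof.
move=> exy; have pp : same_wall x p (p * ev [:: (y, c)]).
  rewrite /same_wall mulKg; apply/raag_subP; exists [:: (y, c)] => //=.
  by rewrite finset.inE exy.
apply/asboolP/asboolP => qp; apply: (same_wall_trans qp) => //.
exact: same_wall_sym.
Qed.

(** A backtrack crosses one wall twice. Around a commutation square, the edges labelled [x] are
    opposite sides and cross the same wall, since the other label lies in the link of [x]. So each
    wall separates the Cayley graph. *)
Lemma parity_eq x q g u v : simple_graph e ->
  pres_eq (raag_relator e) u v -> parity x q g u = parity x q g v.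
Proof.
move=> [esym eirr] uv; elim: uv g => {u v}.
- by [].
- by move=> u v _ IH g; rewrite IH.
- by move=> u v w _ IHu _ IHv g; rewrite IHu IHv.
- move=> u v y b g; rewrite !parity_cat /= addbF.
  have -> : org (g * ev u * ev [:: (y, b)]) (y, ~~ b) = org (g * ev u) (y, b).
    exact: org_linv.
  by rewrite addbb ev_cons (ev_linv e (y, b)) mulgV mulg1.
move=> u v r [y [z [eyz ->]]] g; rewrite !parity_cat /= addbF.
have -> : ev [:: (y, false); (z, false); (y, true); (z, true)] = 1.
  apply/pres_classP.
  have : raag_relator e [:: (y, false); (z, false); (y, true); (z, true)].
    by exists y, z.
  exact: (pres_relator [::] [::]).
rewrite mulg1; set g' := g * ev u.
rewrite /org /=.
have [xy|yx] := eqVneq y x; have [zx|zx] := eqVneq z x => //=.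
- by move: eyz; rewrite xy zx eirr.
- rewrite -{}xy (@same_wall_link y z) //.
  by rewrite addbF addbb.
- rewrite -zx (@same_wall_link z y); last by rewrite esym.
  by rewrite addbb.
Qed.

Lemma parityP x q g w : parity x q g w ->
  exists u (b : bool) v, w = u ++ (x, b) :: v /\ same_wall x q (org (g * ev u) (x, b)).
Proof.
elim: w g => //= -[y c] w IH g; case: (boolP (_ && _)) => [|_ /= /IH].
  case/andP=> /= /eqP -> /asboolP xq _; exists [::], c, w.
  by rewrite ev_nil mulg1.
case=> u [b [v [-> xq]]]; exists ((y, c) :: u), b, v; split=> //.
by rewrite (ev_cons e (y, c)) mulgA.
Qed.

End Walks.

(** * The invariant spanning tree *)

Section SpanningTree.
Variables (V : finType) (e : rel V) (H : set (raag e)) (r : V -> nat).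
Local Notation G := (raag e).
Local Notation letter := (V * bool)%type.
Local Notation ev := (@ev V e).
Implicit Types (u v w : word V) (a : letter) (x y : V) (g h k p q : G).

Definition lower x : {set V} := [set y | e x y & (r y < r x)%N]%SET.

Record equivariant_section (E : V -> set G) : Prop := EquivariantSection {
  section_act : forall x k g, H k -> E x g -> E x (k * g);
  section_uniq : forall x g g', E x g -> E x g' ->
    raag_sub (lower x) (g^-1 * g') -> g = g';
  section_exists : forall x g, exists2 c, raag_sub (lower x) c & E x (g * c) }.

(** Pick one element in each double coset [H g A(lower x)] and take all its [H]-translates. Since
    [lower x] lies in the star of [x], [H] acts freely on the cosets of [A(lower x)], so no coset
    receives two translates. *)
Lemma equivariant_section_exists :
  subgroup H -> star_free H -> exists E, equivariant_section E.
Proof.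
move=> sH sfH.
have H1 := subgroup1 sH; have HM k k' := @subgroupM _ _ k k' sH.
have HV k := @subgroupV _ _ k sH.
have L1 x := subgroup1 (raag_sub_subgroup e (lower x)).
have LM x k k' := @subgroupM _ _ k k' (raag_sub_subgroup e (lower x)).
have LV x k := @subgroupV _ _ k (raag_sub_subgroup e (lower x)).
pose dc x g : set G :=
  [set g' | exists k c, [/\ H k, raag_sub (lower x) c & g' = k * g * c]].
have dcE x g g' : dc x g g' -> dc x g = dc x g'.
  move=> [k [c [Hk Lc ->]]]; rewrite predeqE => p; split=> -[k' [c' [Hk' Lc' ->]]].
    exists (k' * k^-1), (c^-1 * c'); split; [by auto|by auto|by gsimp].
  by exists (k' * k), (c * c'); split; [auto|auto|gsimp].
have freeL x k g : H k -> raag_sub (lower x) (g^-1 * (k * g)) -> k = 1.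
  move=> Hk Lk; apply: (sfH k x g Hk); apply: raag_subS Lk.
  by apply/fintype.subsetP => y; rewrite !finset.inE => /andP[-> _]; rewrite orbT.
(* The default [1] is never taken, as [dc x g] contains [g]. *)
pose E x : set G := [set g | exists2 k, H k & g = k * xget 1 (dc x g)].
exists E; split.
- move=> x k g Hk [k' Hk' gE]; exists (k * k'); first exact: HM.
  rewrite -(_ : dc x g = dc x (k * g)); last first.
    by apply: dcE; exists k, 1; split=> //; gsimp.
  by rewrite {1}gE mulgA.
- move=> x g g' [k Hk gE] [k' Hk' gE'] Lg.
  have dE : dc x g = dc x g'.
    by apply: dcE; exists 1, (g^-1 * g'); split=> //; gsimp.
  rewrite -dE in gE'; set p := xget 1 (dc x g) in gE gE'.
  have kk : k^-1 * k' = 1.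
    by apply: (freeL x _ p); [auto|move: Lg; rewrite gE gE'; gsimp].
  by rewrite gE gE' -(mulg1_eq kk) invgK.
- move=> x g.
  have [k [c [Hk Lc pE]]] : dc x g (xget 1 (dc x g)).
    by apply: (@xgetI _ 1 (dc x g) g); exists 1, 1; split=> //; gsimp.
  exists c => //; exists k^-1; first exact: HV.
  rewrite -(_ : dc x g = dc x (g * c)); last first.
    by apply: dcE; exists 1, c; split=> //; gsimp.
  by rewrite pE; gsimp.
Qed.

Variable E : V -> set G.
Hypotheses (sE : equivariant_section E) (sH : subgroup H).
Hypotheses (sg : simple_graph e) (r_inj : injective r).

Definition edge g a : Prop := E a.1 (org g a).

Lemma edge_act k g a : H k -> edge (k * g) a <-> edge g a.
Proof.
move=> Hk; rewrite /edge orgM; split=> Eg; last exact: (section_act sE).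
rewrite -[org g a](mulKg k); apply: (section_act sE) => //; exact: subgroupV.
Qed.

Lemma edge_linv g a : edge g a -> edge (g * ev [:: a]) (linv a).
Proof. by rewrite /edge org_linv. Qed.

Lemma walk_edge_act k g w : H k -> walk edge (k * g) w <-> walk edge g w.
Proof.
move=> Hk; split; last by apply: walk_trans => p a; rewrite edge_act.
rewrite -{2}[g](mulKg k); apply: walk_trans => p a.
by rewrite edge_act //; apply: subgroupV.
Qed.

(** Induction on the rank bound: a letter [x] is replaced by [c x c^-1], where [c] in [A(lower x)]
    moves the origin of the edge to a chosen element. This [c] commutes with [x], and [c] and its
    inverse are spelled along the tree with letters of smaller rank. *)
Lemma walk_exists n g w : all (fun a => r a.1 < n)%N w ->
  exists w', [/\ walk edge g w', all (fun a => r a.1 < n)%N w' & ev w' = ev w].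
Proof.
elim: n g w => [|n IH] g w; first by case: w => // _; exists [::].
elim: w g => [|[x b] w IHw] g /=; first by exists [::].
case/andP=> xn /(IHw (g * ev [:: (x, b)]))[w1 [w1E w1n w1w]].
suff [w2 [w2E w2n w2x]] : exists w', [/\ walk edge g w',
    all (fun a => r a.1 < n.+1)%N w' & ev w' = ev [:: (x, b)]].
  exists (w2 ++ w1); split; last by rewrite ev_cat w2x w1w -ev_cons.
    by rewrite walk_cat w2x.
  by rewrite all_cat w2n.
have {}IH g' c : raag_sub (lower x) c -> exists w', [/\ walk edge g' w',
    all (fun a => r a.1 < n.+1)%N w' & ev w' = c].
  case/raag_subP=> u ul uc; have [|w' [w'E w'n w'u]] := IH g' u.
    apply: sub_all ul => a; rewrite finset.inE => /andP[_ ax].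
    by apply: leq_trans ax _; rewrite -ltnS.
  exists w'; split=> //; last by rewrite w'u.
  by apply: sub_all w'n => a /ltnW.
have [c Lc Ec] := section_exists sE x (org g (x, b)).
have [u1 [u1E u1n u1c]] := IH g c Lc.
have [u2 [u2E u2n u2c]] := IH (g * c * ev [:: (x, b)]) c^-1
  (subgroupV (raag_sub_subgroup _ _) Lc).
have cx : c * ev [:: (x, b)] = ev [:: (x, b)] * c.
  apply: link_commute; apply: raag_subS Lc.
  by apply/fintype.subsetP => y; rewrite !finset.inE => /andP[].
have gcE : org (g * c) (x, b) = org g (x, b) * c.
  by rewrite /org; case: (b) cx => //= cx; rewrite -!mulgA cx.
exists (u1 ++ (x, b) :: u2); split.
- rewrite walk_cat /= u1c; split=> //; split=> //.
  by rewrite /edge gcE.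
- by rewrite all_cat /= u1n u2n xn.
by rewrite ev_cat ev_cons u1c u2c mulgA cx mulgK.
Qed.

(** The two origins differ by an element of [A(link x)] spelled with ranks at most [r x], hence of
    [A(lower x)]. Both are chosen elements, so they coincide and the same edge is traversed twice;
    this closes up a shorter loop. Acyclicity is assumed below length [N] only, so that the lemma
    can serve in the induction proving it. *)
Lemma recross_aux N :
  (forall g w, (size w < N)%N -> walk edge g w -> reduced w -> ev w = 1 -> w = [::]) ->
  forall g x (b c : bool) m, ((size m).+1 < N)%N ->
  walk edge g ((x, b) :: rcons m (x, c)) -> reduced ((x, b) :: rcons m (x, c)) ->
  all (fun a => r a.1 <= r x)%N m ->
  ~ same_wall x (org g (x, b)) (org (g * ev ((x, b) :: m)) (x, c)).
Proof.
move=> IH g x b c m mN wE red mx.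
rewrite -cats1 -cat_cons in wE red.
have [w1 [w2 _]] := (walk_cat _ _ _ _).1 wE.
have red1 := reduced_catl red; have red2 := @reduced_catr _ [:: (x, b)] _ red.
have E1 : E x (org g (x, b)) by case: w1.
set q1 := org _ _ in E1 *; set q2 := org _ _ in w2 * => xq.
have q12 : q1 = q2.
  apply: (section_uniq sE) E1 w2 _.
  pose M : {set V} := [set y | r y <= r x]%SET.
  have Mev u : all (fun a => r a.1 <= r x)%N u -> raag_sub M (ev u).
    move=> ux; apply/raag_subP; exists u => //; apply: sub_all ux => a.
    by rewrite finset.inE.
  have sM := raag_sub_subgroup e M.
  suff Mq : raag_sub M (q1^-1 * q2).
    apply: raag_subS (raag_subI xq Mq); apply/fintype.subsetP => y.
    rewrite !finset.inE => /andP[exy yx]; rewrite exy ltn_neqAle yx andbT /=.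
    by apply/eqP => /r_inj yx'; move: exy; rewrite yx' sg.2.
  have M1 d : raag_sub M (ev [:: (x, d)]) by apply: Mev; rewrite /= leqnn.
  have M2 : raag_sub M (ev ((x, b) :: m)) by apply: Mev; rewrite /= leqnn.
  have -> : q1^-1 * q2 = (g^-1 * q1)^-1 * (g^-1 * q2) by gsimp.
  apply: (subgroupM sM); first apply: (subgroupV sM).
    by rewrite /q1 /org /=; case: (b) => //; rewrite ?mulVg ?mulKg //; apply: (subgroup1 sM).
  rewrite /q2 /org /=; case: (c); rewrite -?mulgA mulKg //.
  exact: (subgroupM sM).
have mnil : walk edge (g * ev [:: (x, b)]) m -> ev m = 1 -> c = ~~ b -> False.
  move=> wm m1 cb; have mE := IH _ _ (ltnW mN) wm (reduced_catl red2) m1.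
  by move: red; rewrite mE cb /reduced /= eqxx.
move: q12; rewrite /q1 /q2 /org /= {q1 q2 E1 w2 xq}.
(* With equal signs the loop is [m] together with one of the two edges. With opposite signs it is
   [m] itself, which is then empty, and the two letters would be a backtrack. *)
case: b c w1 wE red red1 red2 mnil => [] [] w1 wE red red1 red2 mnil.
- rewrite -{1}[g]mulg1 => /mulgI/esym z1.
  by have := IH g ((x, true) :: m) mN w1 red1 z1.
- rewrite (ev_cons e _ m) (ev_linv e (x, true)); set X := ev _ => gX.
  apply: mnil => //; first by case: w1.
  have -> : ev m = X^-1 * g^-1 * (g * (X * ev m) * X^-1) * X by gsimp.
  by rewrite -gX; gsimp.
- rewrite (ev_cons e _ m); set X := ev _ => gX.
  apply: mnil => //; first by case: w1.
  have -> : ev m = X^-1 * g^-1 * (g * (X * ev m)) by gsimp.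
  by rewrite -gX; gsimp.
- rewrite (ev_cons e _ m); set X := ev _ => gX.
  suff : m ++ [:: (x, false)] = [::] by case: (m).
  apply: (IH (g * X)) => //; [by rewrite size_cat addn1|by case: wE|].
  have -> : ev (m ++ [:: (x, false)]) = X^-1 * g^-1 * (g * (X * ev m) * X).
    by rewrite ev_cat; gsimp.
  by rewrite -gX; gsimp.
Qed.

(** Strong induction on the length. A closed walk crosses every wall an even number of times, so the
    wall of a letter of maximal rank is crossed again, before or after that letter; [recross_aux]
    forbids both. *)
Lemma acyclic g w : walk edge g w -> reduced w -> ev w = 1 -> w = [::].
Proof.
have [N] := ubnP (size w); elim: N g w => // N IH g w; rewrite ltnS => wN wE red w1.
apply/eqP; apply: contraT; rewrite -size_eq0 -lt0n => w0.
have [[x b] xw xmax] : exists2 a, a \in w & {in w, forall c, r c.1 <= r a.1}%N.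
  case: (w) w0 => // a0 s _.
  have [a aw amax] := arg_maxnP (fun a : letter => r a.1) (mem_head a0 s).
  by exists a.
case/splitPr: xw wN wE red w1 xmax {w0} => u v wN wE red w1 xmax.
have wr a : a \in u ++ v -> (r a.1 <= r x)%N.
  by move=> auv; apply: xmax; move: auv; rewrite !mem_cat inE orbCA => ->; rewrite orbT.
pose q := org (g * ev u) (x, b).
have : parity x q g (u ++ (x, b) :: v) = false.
  by rewrite (@parity_eq _ _ _ _ _ _ [::] sg) //; apply/pres_classP.
rewrite parity_cat /= eqxx (asboolT (@same_wall_refl _ e x q)) /=.
have sub_wr s : {subset s <= u ++ v} -> all (fun a => r a.1 <= r x)%N s.
  by move=> suv; apply/allP => a /suv/wr.
have [/parityP[u1 [c [u2 [uE qc]]]] _|_] := boolP (parity _ _ _ u).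
  move: wE red wN; rewrite uE -catA cat_cons -(cat_rcons (x, b) u2) -(cat_cons (x, c)).
  case/walk_cat=> _ /walk_cat[wE _] /reduced_catr/reduced_catl red wN.
  case: (recross_aux IH _ wE red).
  - by move: wN; rewrite !size_cat /= size_rcons; lia.
  - by apply: sub_wr => a; rewrite uE !mem_cat inE => ->; rewrite !orbT.
  - apply: same_wall_sym; move: qc; rewrite /q uE.
    by rewrite ev_cat !mulgA.
case: (boolP (parity _ _ _ v)) => // /parityP[v1 [c [v2 [vE qc]]]] _.
move: wE red wN; rewrite vE -(cat_rcons (x, c) v1) -(cat_cons (x, b)).
case/walk_cat=> _ /walk_cat[wE _] /reduced_catr/reduced_catl red wN.
case: (recross_aux IH _ wE red).
- by move: wN; rewrite !size_cat /= size_rcons; lia.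
- by apply: sub_wr => a; rewrite vE !mem_cat inE => ->; rewrite !orbT.
- by move: qc; rewrite (ev_cons e _ v1) !mulgA.
Qed.

Lemma recross g x (b c : bool) m :
  walk edge g ((x, b) :: rcons m (x, c)) -> reduced ((x, b) :: rcons m (x, c)) ->
  all (fun a => r a.1 <= r x)%N m ->
  ~ same_wall x (org g (x, b)) (org (g * ev ((x, b) :: m)) (x, c)).
Proof.
by apply: (@recross_aux (size m).+2) => // g' w _; apply: acyclic.
Qed.

(** After removal of the common prefix, going back along [u] and then along [v] would be a nonempty
    reduced loop. *)
Lemma walk_uniq g u v : walk edge g u -> walk edge g v ->
  reduced u -> reduced v -> ev u = ev v -> u = v.
Proof.
elim: u g v => [|a u IH] g [|b v] //.
- by move=> _ wv _ rv /esym v1; rewrite (acyclic wv rv v1).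
- by move=> wu _ ru _ u1; rewrite (acyclic wu ru u1).
move=> wu wv ru rv uv; have [ab|ab] := eqVneq a b.
  rewrite ab in wu uv *; congr cons; apply: (IH (g * ev [:: b])).
  - by case: wu.
  - by case: wv.
  - exact: (@reduced_catr _ [:: a]).
  - exact: (@reduced_catr _ [:: b]).
  - by move: uv; rewrite (ev_cons e b u) (ev_cons e b v) => /mulgI.
suff : inv_word (a :: u) ++ b :: v = [::] by case: (inv_word _).
apply: (acyclic (g := g * ev (a :: u))).
- rewrite walk_cat ev_inv mulgK; split=> //.
  by apply: walk_inv wu => p c; apply: edge_linv.
- have := reduced_inv ru; rewrite -[a :: u]/([:: a] ++ u) inv_word_cat.
  rewrite !cats1 => ru'; rewrite cat_rcons; apply: reduced_cons_cat => //.
  by rewrite /reduced /= linvK eq_sym ab.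
- by rewrite ev_cat ev_inv uv mulVg.
Qed.

Lemma path_exists g h : exists w, [/\ walk edge g w, reduced w & g * ev w = h].
Proof.
have [w0 gh] := ev_surj (g^-1 * h).
have [|w [wE _ ww0]] := @walk_exists (\max_(x : V) r x).+1 g w0.
  by apply/allP => a _; rewrite ltnS; apply: leq_bigmax.
exists (reduce w); split; [exact: walk_reduce|exact: reduce_reduced|].
by rewrite ev_reduce ww0 -gh mulVKg.
Qed.

(** [walk_exists] supplies a tree walk of rank below [n] with the same ends, and uniqueness
    identifies its reduction with [w]. *)
Lemma path_low n g w : walk edge g w -> reduced w ->
  raag_sub [set y | r y < n]%SET (ev w) -> all (fun a => r a.1 < n)%N w.
Proof.
move=> wE rw /raag_subP[u un uw].
have [|u' [u'E u'n u'u]] := @walk_exists n g u.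
  by apply: sub_all un => a; rewrite finset.inE.
suff -> : w = reduce u'.
  apply: (@walk_all _ e (fun _ a => r a.1 < n)%N 1) => //.
  by apply/(@walk_reduce _ e _ 1)/all_walk.
apply: (walk_uniq wE) => //; [exact: walk_reduce|exact: reduce_reduced|].
by rewrite ev_reduce u'u.
Qed.

End SpanningTree.

(** * Word lengths *)

Section Expressible.
Variable G : groupType.
Implicit Types (H : set G) (s t : seq G) (g h x : G) (m n : nat).

Lemma expressible1 s : expressible s 1 0.
Proof. by exists [::]; rewrite big_nil. Qed.

Lemma expressible_mem s x : x \in s -> expressible s x 1.
Proof. by move=> xs; exists [:: x]; rewrite /= xs big_seq1. Qed.

Lemma expressibleM s g h m n :
  expressible s g m -> expressible s h n -> expressible s (g * h) (m + n).
Proof.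
move=> [u [<- us <-]] [v [<- vs <-]]; exists (u ++ v).
by rewrite size_cat all_cat us vs big_cat.
Qed.

Lemma expressibleV s g n : expressible s g n -> expressible s g^-1 n.
Proof.
move=> [u [<- us <-]]; exists (rev (map inv u)); split.
- by rewrite size_rev size_map.
- rewrite all_rev all_map; apply: sub_all us => x /=.
  by rewrite invgK orbC.
elim: u {us} => [|x u IH]; first by rewrite !big_nil invg1.
by rewrite /= rev_cons -cats1 big_cat big_seq1 big_cons invgM IH.
Qed.

Lemma gen_subgroupP s g : gen_subgroup [set` s] g <-> exists n, expressible s g n.
Proof.
split=> [|[n [w [_ ws <-]]]].
  pose P : set G := [set g | exists n, expressible s g n].
  apply: (@gen_subgroup_sub _ _ P); last first.
    by move=> x xs; exists 1%N; apply: expressible_mem.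
  apply: subgroup_closed; first by exists 0%N; apply: expressible1.
  - by move=> x y [m xm] [n yn]; exists (m + n)%N; apply: expressibleM.
  - by move=> x [m xm]; exists m; apply: expressibleV.
have sG := @gen_subgroup_subgroup G [set` s].
elim: w ws => [|x w IH] /=; first by rewrite big_nil => _; apply: (subgroup1 sG).
rewrite big_cons => /andP[xs /IH]; apply: (subgroupM sG).
case/orP: xs => xs; first exact: sub_gen_subgroup.
by rewrite -[x]invgK; apply: (subgroupV sG); apply: sub_gen_subgroup.
Qed.

(** A change of generators is Lipschitz: [c] bounds the lengths of expressions over [s] of the
    finitely many elements of [t]. *)
Lemma expressible_trans s t : (forall x, x \in t -> exists n, expressible s x n) ->
  exists c, forall g n, expressible t g n ->
    exists2 m, (m <= c * n)%N & expressible s g m.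
Proof.
move=> ts; have [c tc] : exists c, forall x, x \in t ->
    exists2 m, (m <= c)%N & expressible s x m.
  elim: t ts => [|x t IH] ts; first by exists 0%N.
  have [c tc] := IH (fun y yt => ts y (mem_behead (s := x :: t) yt)).
  have [n xn] := ts x (mem_head _ _); exists (maxn n c) => y.
  rewrite inE => /predU1P[->|/tc[m mc ym]]; first by exists n; rewrite ?leq_maxl.
  by exists m => //; rewrite leq_max mc orbT.
exists c => g n [w [<- wt <-]] {g n}.
elim: w wt => [|x w IH] /=; first by exists 0%N; rewrite ?big_nil //; apply: expressible1.
case/andP=> xt /IH[m mc wm].
have [n nc xn] : exists2 n, (n <= c)%N & expressible s x n.
  case/orP: xt => /tc[n nc xn]; exists n => //.
  by rewrite -[x]invgK; apply: expressibleV.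
exists (n + m)%N; first by rewrite mulnS leq_add.
by rewrite big_cons; apply: expressibleM.
Qed.

Lemma word_lengthP s g : (exists n, expressible s g n) ->
  expressible s g (word_length s g) /\
  forall n, expressible s g n -> (word_length s g <= n)%N.
Proof.
move=> [n gn]; rewrite /word_length; case: pselect => [ex|[]].
  by case: ex_minnP => m /asboolP gm mmin; split=> // k gk; apply/mmin/asboolP.
by exists n; apply/asboolP.
Qed.

End Expressible.

(** * Finiteness modulo H *)

Section Cofinite.
Variables (V : finType) (e : rel V) (H : set (raag e)) (r : V -> nat).
Local Notation G := (raag e).
Local Notation letter := (V * bool)%type.
Local Notation ev := (@ev V e).
Implicit Types (u v w : word V) (a : letter) (x y : V) (g h k p q d : G) (D : seq G).
Variable E : V -> set G.
Hypotheses (sE : equivariant_section H r E) (sH : subgroup H).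
Hypotheses (sg : simple_graph e) (r_inj : injective r).

(** The union of the [H]-orbits meeting a finite list: this is how subgraphs with finite quotient by
    [H] are encoded. *)
Definition orbits D g : Prop := exists2 k, H k & k * g \in D.

Lemma orbits_act D k g : H k -> orbits D g -> orbits D (k * g).
Proof.
move=> Hk [k' Hk' kg]; exists (k' * k^-1); last by gsimp.
by apply: subgroupM => //; apply: subgroupV.
Qed.

Definition edge_in D g a : Prop :=
  [/\ edge E g a, orbits D g & orbits D (g * ev [:: a])].

Lemma edge_in_linv D g a : edge_in D g a -> edge_in D (g * ev [:: a]) (linv a).
Proof.
case=> Eg Dg Dga; split=> //; first exact: edge_linv.
by rewrite ev_linv mulgK.
Qed.

Lemma edge_in_sub D D' g a : {subset D <= D'} -> edge_in D g a -> edge_in D' g a.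
Proof.
move=> DD' [? [k Hk kg] [k' Hk' kg']].
by split=> //; [exists k|exists k'] => //; apply: DD'.
Qed.

Lemma edge_in_act D k g a : H k -> edge_in D g a -> edge_in D (k * g) a.
Proof.
move=> Hk [? ? ?]; split; first by rewrite (edge_act sE sH).
  exact: orbits_act.
by rewrite -mulgA; apply: orbits_act.
Qed.

Lemma walk_edge_in g w : walk (edge E) g w -> exists D, walk (edge_in D) g w.
Proof.
have orb1 D p : p \in D -> orbits D p.
  by move=> pD; exists 1; rewrite ?mul1g //; apply: subgroup1.
elim: w g => [|a w IH] g /=; first by exists [::].
case=> ga /IH[D wD]; exists [:: g, g * ev [:: a] & D]; split.
  by split=> //; apply: orb1; rewrite !inE eqxx ?orbT.
by apply: walk_sub wD => p b; apply: edge_in_sub => q qD; rewrite !inE qD !orbT.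
Qed.

(** [D] collects the vertices of tree paths from 1 to the generators of [H]. Translates of these
    paths concatenate to a walk to any element of [H], and reducing that walk gives the tree path
    without leaving the orbits of [D]. *)
Lemma cofinite : fin_gen H -> exists D, forall w,
  H (ev w) -> walk (edge E) 1 w -> reduced w -> walk (edge_in D) 1 w.
Proof.
case=> s sgen; have [D sD] : exists D, forall z, z \in s ->
    exists2 w, walk (edge_in D) 1 w & ev w = z.
  elim: (s) => [|z t [D tD]]; first by exists [::].
  have [w [wE _ w1]] := path_exists sE 1 z.
  have [D' wD'] := walk_edge_in wE; exists (D ++ D') => z'.
  rewrite inE => /predU1P[->|/tD[u uD uz]].
    exists w; last by rewrite -w1 mul1g.
    by apply: walk_sub wD' => p a; apply: edge_in_sub => q; rewrite mem_cat orbC => ->.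
  exists u => //.
  by apply: walk_sub uD => p a; apply: edge_in_sub => q; rewrite mem_cat => ->.
exists D => w Hw wE rw.
pose P : set G := [set h | H h /\ exists2 w, walk (edge_in D) 1 w & ev w = h].
have HP : H `<=` P.
  have sHgen : [set` s] `<=` H by rewrite -sgen; apply: sub_gen_subgroup.
  rewrite -{1}sgen; apply: gen_subgroup_sub; last first.
    by move=> z zs; split; [apply: sHgen|apply: sD].
  apply: subgroup_closed.
  - by split; [apply: subgroup1|exists [::]].
  - move=> g h [Hg [u uD ug]] [Hh [v vD vh]]; subst g h; split; first exact: subgroupM.
    exists (u ++ v); last by rewrite ev_cat.
    rewrite walk_cat; split=> //; rewrite mul1g -[X in walk _ X](mulg1 (ev u)).
    by apply: walk_trans vD => p a; apply: edge_in_act.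
  - move=> g [Hg [u uD ug]]; subst g; split; first exact: subgroupV.
    exists (inv_word u); last by rewrite ev_inv.
    rewrite -[X in walk _ X](mulVg (ev u)); apply: (@walk_trans _ _ (edge_in D)).
      by move=> p a; apply: edge_in_act; apply: subgroupV.
    rewrite -[X in walk _ X]mul1g; apply: walk_inv => // p a; exact: edge_in_linv.
have [_ [u uD uw]] := HP _ Hw.
suff -> : w = reduce u by apply: walk_reduce.
apply: (walk_uniq sE sg r_inj wE) => //; last by rewrite ev_reduce.
  by apply: walk_reduce; apply: walk_sub uD => p a [].
exact: reduce_reduced.
Qed.

(* The quotient of the tree spanned by the H-orbit of 1 is finite, and the
   part of it lying in A(L) embeds into it: this makes H_L finitely generated. *)
Lemma low_generators n : fin_gen H ->
  exists s, (forall z, z \in s -> (H `&` raag_sub [set y | r y < n]%SET) z) /\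
  forall w, (H `&` raag_sub [set y | r y < n]%SET) (ev w) ->
    walk (edge E) 1 w -> reduced w -> expressible s (ev w) (size w).+1.
Proof.
move=> fgH; have [D DP] := cofinite fgH.
set L : {set V} := [set y | r y < n]%SET; set K := H `&` _.
have sL := raag_sub_subgroup e L.
have sK : subgroup K by apply: subgroupI.
(* A point of the orbit of [d] inside [A(L)], or the harmless default [1] if there is none. *)
pose rep d := xget 1 [set d' | raag_sub L d' /\ exists2 k, H k & d' = k * d].
pose D' := 1 :: map rep D.
have D'P g : raag_sub L g -> orbits D g ->
    exists2 k, K k & exists2 d, d \in D' & g = k * d.
  move=> Lg [k Hk kgD]; exists (g * (rep (k * g))^-1); last first.
    by exists (rep (k * g)); [rewrite inE map_f ?orbT|gsimp].
  have [Lr [k' Hk' rE]] : [set d' | raag_sub L d' /\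
      exists2 k', H k' & d' = k' * (k * g)] (rep (k * g)).
    apply: (@xgetI _ 1 _ g); split=> //; exists k^-1; first exact: subgroupV.
    by rewrite mulKg.
  split; last exact: (subgroupM sL Lg (subgroupV sL Lr)).
  have -> : g * (rep (k * g))^-1 = (k' * k)^-1 by rewrite rE; gsimp.
  by apply: subgroupV => //; apply: subgroupM.
(* The products [d a d'^-1] compare the representatives at the two ends of an edge; [D'] itself is
   included for the last factor of the final decomposition. *)
pose s0 := D' ++ [seq z * z'^-1 |
  z <- [seq d * ev [:: a] | d <- D', a <- enum {: letter}], z' <- D'].
exists [seq z <- s0 | `[< K z >]]; set s := filter _ _.
split=> [z|]; first by rewrite mem_filter => /andP[/asboolP].
(* Each vertex is written [k * d] with [k] in [K] and [d] in [D']. Crossing an edge multiplies [k]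
   on the right by one [d a d1^-1], so one generator is spent per letter. *)
have along w g k d : walk (edge_in D) g w -> all (fun a => a.1 \in L) w ->
    raag_sub L g -> K k -> d \in D' -> g = k * d ->
    exists k' d', [/\ K k', d' \in D', g * ev w = k' * d' &
      expressible s (k^-1 * k') (size w)].
  elim: w g k d => [|a w IH] g k d /=.
    by move=> *; exists k, d; split; rewrite ?ev_nil ?mulg1 ?mulVg //; apply: expressible1.
  move=> [[_ _ Dga] wD] /andP[La Lw] Lg Kk dD' gE.
  have Lga : raag_sub L (g * ev [:: a]).
    by apply: (subgroupM sL) => //; apply/raag_subP; exists [:: a]; rewrite //= La.
  have [k1 Kk1 [d1 d1D' gaE]] := D'P _ Lga Dga.
  have [k' [d' [Kk' d'D' wE ks]]] := IH _ _ _ wD Lw Lga Kk1 d1D' gaE.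
  exists k', d'; split=> //; first by rewrite (ev_cons e a w) mulgA.
  have -> : k^-1 * k' = (k^-1 * k1) * (k1^-1 * k') by gsimp.
  rewrite -add1n; apply: expressibleM => //; apply: expressible_mem.
  rewrite mem_filter; apply/andP; split.
    by apply/asboolP; apply: (subgroupM sK) => //; apply: (subgroupV sK).
  have -> : k^-1 * k1 = d * ev [:: a] * d1^-1.
    have -> : d = k^-1 * g by rewrite gE mulKg.
    by rewrite -[k^-1 * g * _]mulgA gaE; gsimp.
  rewrite mem_cat; apply/orP; right; apply: allpairs_f => //.
  by apply: allpairs_f => //; rewrite mem_enum.
move=> w Kw wE rw.
have wL : all (fun a => a.1 \in L) w.
  have := path_low sE sg r_inj wE rw Kw.2; apply: sub_all => a.
  by rewrite finset.inE.
have [||||k' [d' [Kk' d'D' wkd ks]]] := along w 1 1 1 (DP _ Kw.1 wE rw) wL.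
- exact: (subgroup1 sL).
- exact: (subgroup1 sK).
- by rewrite inE eqxx.
- by rewrite mulg1.
(* The endpoint [k' * d'] lies in [K], so [d'] is itself a generator; it accounts for the extra unit
   of length. *)
rewrite mul1g in wkd; rewrite invg1 mul1g in ks; rewrite {1}wkd -addn1.
apply: expressibleM => //; apply: expressible_mem.
rewrite mem_filter mem_cat d'D' andbT; apply/asboolP.
by apply/(subgroupMl d' sK Kk'); rewrite -wkd.
Qed.

End Cofinite.

(** * Freeness *)

Section FreeLift.
Variables (S : choiceType) (G : groupType) (phi : S -> G).
Implicit Types w : word S.

Definition lift_word w : G :=
  \prod_(a <- w) (if a.2 then phi a.1 else (phi a.1)^-1).

Definition free_lift (g : free_group S) : G := lift_word (repr g).

Lemma free_liftE w : free_lift (pres_class _ w) = lift_word w.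
Proof.
have liftE u v : pres_eq (fun _ : word S => False) u v -> lift_word u = lift_word v.
  elim=> {u v} // [u v w' _ -> _ ->|u v x b] //.
  rewrite /lift_word !big_cat !big_cons big_nil /= mulg1.
  by case: b => /=; rewrite ?mulgV ?mulVg mul1g.
exact/liftE/pres_repr.
Qed.

Lemma free_liftM : {morph free_lift : g h / g * h}.
Proof.
move=> g h; have [u ->] := pres_class_surj g; have [v ->] := pres_class_surj h.
by rewrite -[_ * _]/(pres_mul _ _) pres_mulE !free_liftE /lift_word big_cat.
Qed.

Lemma free_lift1 : free_lift 1 = 1.
Proof. by rewrite -[1]/(pres_class _ [::]) free_liftE /lift_word big_nil. Qed.

Lemma free_liftV : {morph free_lift : g / g^-1}.
Proof.
move=> g; apply/esym/mulg1_eq.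
by rewrite -free_liftM mulgV free_lift1.
Qed.

Lemma free_lift_gen s : free_lift (pres_gen _ s) = phi s.
Proof. by rewrite /pres_gen free_liftE /lift_word big_seq1. Qed.

End FreeLift.

Lemma free_group_ind (S : choiceType) (P : free_group S -> Prop) :
  P 1 -> (forall s g, P g -> P (pres_gen _ s * g)) ->
  (forall s g, P g -> P ((pres_gen _ s)^-1 * g)) -> forall g, P g.
Proof.
move=> P1 PM PV g; have [w ->] := pres_class_surj g.
elim: w => [//|[s b] w Pw].
rewrite -cat1s -pres_mulE; case: b; first exact: PM.
have -> : pres_class (fun=> False) [:: (s, false)] = (pres_gen _ s)^-1.
  by rewrite -[_^-1]/(pres_inv _) /pres_gen pres_invE.
exact: PV.
Qed.

(** * Shortlex numbering of words *)

Section WordCode.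
Variable T : finType.
Implicit Types (w u v : seq T) (a : T).

(* Bijective base-#|T| numeration: the order induced by [code] is shortlex. *)
Definition code w : nat :=
  foldl (fun n a => n * #|T| + (enum_rank a).+1)%N 0%N w.

Lemma code_rcons w a : code (rcons w a) = (code w * #|T| + (enum_rank a).+1)%N.
Proof. by rewrite /code -cats1 foldl_cat. Qed.

Lemma code_lt_rcons w a : (code w < code (rcons w a))%N.
Proof.
rewrite code_rcons addnS ltnS; apply: leq_trans (leq_addr _ _).
by apply/leq_pmulr/card_gt0P; exists a.
Qed.

Lemma code_ltn u v a : (code u < code v)%N -> (code (rcons u a) < code (rcons v a))%N.
Proof.
have := ltn_ord (enum_rank a); rewrite !code_rcons.
by rewrite ltn_add2r => T0 uv; rewrite ltn_mul2r uv (leq_ltn_trans _ T0).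
Qed.

Lemma code_inj : injective code.
Proof.
elim/last_ind => [|u a IH]; elim/last_ind => [|v b _] //.
- by move=> c; have := code_lt_rcons v b; rewrite -c.
- by move=> c; have := code_lt_rcons u a; rewrite c.
rewrite !code_rcons => c.
have ua := ltn_ord (enum_rank a); have ub := ltn_ord (enum_rank b).
have T0 : (0 < #|T|)%N by apply: leq_ltn_trans ua.
have uv : code u = code v.
  move: c; rewrite !addnS => -[/(congr1 (divn^~ #|T|))].
  by rewrite /= !divnMDl // !divn_small // !addn0.
rewrite (IH _ uv); congr rcons; apply/enum_rank_inj/ord_inj.
by move: c; rewrite uv; lia.
Qed.

End WordCode.

(** * A free basis of [H] from its free action on the spanning tree *)

Section Freeness.
Variables (V : finType) (e : rel V) (H : set (raag e)) (r : V -> nat).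
Local Notation G := (raag e).
Local Notation letter := (V * bool)%type.
Local Notation ev := (@ev V e).
Implicit Types (u v w : word V) (a : letter) (x y : V) (g h k p q d : G).
Variable E : V -> set G.
Hypotheses (sE : equivariant_section H r E) (sH : subgroup H).
Hypotheses (sg : simple_graph e) (r_inj : injective r).

Let H1 : H 1. Proof. exact: subgroup1. Qed.
Let HM k h : H k -> H h -> H (k * h). Proof. exact: subgroupM. Qed.
Let HV k : H k -> H k^-1. Proof. exact: subgroupV. Qed.

Definition path_to g : word V :=
  xget [::] [set w | [/\ walk (edge E) 1 w, reduced w & ev w = g]].

Lemma path_toP g :
  [/\ walk (edge E) 1 (path_to g), reduced (path_to g) & ev (path_to g) = g].
Proof.
have [w [wE rw wg]] := path_exists sE 1 g; rewrite mul1g in wg.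
exact: (@xgetI _ [::] [set w | [/\ walk (edge E) 1 w, reduced w & ev w = g]] w).
Qed.

Lemma path_to_uniq w : walk (edge E) 1 w -> reduced w -> path_to (ev w) = w.
Proof.
move=> wE rw; have [pE rp pw] := path_toP (ev w).
exact: (walk_uniq sE sg r_inj pE).
Qed.

(* A Schreier transversal of the H-orbits, spanning a subtree. *)
Definition dom : set G :=
  [set g | forall k, H k -> (code (path_to g) <= code (path_to (k * g)))%N].

Lemma dom1 : dom 1.
Proof. by move=> k _; rewrite -(ev_nil e) path_to_uniq. Qed.

Lemma dom_exists g : exists2 k, H k & dom (k^-1 * g).
Proof.
pose P n := `[< exists2 k, H k & code (path_to (k * g)) = n >].
have exP : exists n, P n by exists (code (path_to (1 * g))); apply/asboolP; exists 1.
have [n /asboolP[k Hk kn] nmin] := ex_minnP exP.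
exists k^-1; first exact: HV.
rewrite invgK => k' Hk'; rewrite kn; apply: nmin; apply/asboolP.
by exists (k' * k); [exact: HM|rewrite mulgA].
Qed.

Lemma dom_uniq g k : H k -> dom g -> dom (k * g) -> k = 1.
Proof.
move=> Hk dg dkg; have [_ _ pg] := path_toP g; have [_ _ pkg] := path_toP (k * g).
have pp : path_to g = path_to (k * g).
  apply: code_inj; apply/eqP; rewrite eqn_leq dg //=.
  by have := dkg k^-1 (HV Hk); rewrite mulKg.
by apply: (@mulIg _ g); rewrite mul1g -pkg -pp.
Qed.

(** If a translate of [ev w] had a path of smaller code, appending the letter [a] would give a path
    of smaller code to a translate of [ev (rcons w a)]; if that letter backtracks, the path becomes
    shorter still. So [dom] spans a subtree containing 1. *)
Lemma dom_prefix w a : walk (edge E) 1 (rcons w a) -> reduced (rcons w a) ->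
  dom (ev (rcons w a)) -> dom (ev w).
Proof.
rewrite -cats1 => /walk_cat[wE]; rewrite mul1g => -[Ea _] red dwa k Hk.
rewrite (path_to_uniq wE (reduced_catl red)) leqNgt; apply/negP => lt_kw.
have := dwa k Hk; rewrite path_to_uniq // ?walk_cat ?mul1g; last by split=> //=.
rewrite leqNgt cats1 => /negP; apply.
have [pE rp pk] := path_toP (k * ev w); set u := path_to _ in lt_kw pE rp pk.
have uaE : walk (edge E) 1 (rcons u a).
  rewrite -cats1 walk_cat mul1g; split=> //=; split=> //.
  by rewrite pk (edge_act sE sH).
have -> : k * ev (rcons w a) = ev (rcons u a) by rewrite !ev_rcons pk mulgA.
have [rua|] := boolP (reduced (rcons u a)).
  by rewrite path_to_uniq //; apply: code_ltn.
move: lt_kw pE rp uaE {pk}; case/lastP: u => [//|u b] lt_kw.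
rewrite -cats1 => /walk_cat[uE _]; rewrite cats1 => rub _.
rewrite reduced_rcons2 rub /= negbK => /eqP ->.
rewrite !ev_rcons ev_linv mulgK path_to_uniq //; last first.
  by move: rub; rewrite -cats1; apply: reduced_catl.
by apply: ltn_trans (code_lt_rcons _ _); apply: ltn_trans lt_kw; apply: code_lt_rcons.
Qed.

(** The translate of [dom] containing [g]. Contracting every translate to a point turns the spanning
    tree into a tree with vertex set [H]. *)
Definition coset_rep g : G := xget 1 [set k | H k /\ dom (k^-1 * g)].

Lemma coset_repP g : H (coset_rep g) /\ dom ((coset_rep g)^-1 * g).
Proof.
have [k Hk dk] := dom_exists g.
exact: (@xgetI _ 1 [set k | H k /\ dom (k^-1 * g)] k).
Qed.

Lemma coset_rep_uniq g k : H k -> dom (k^-1 * g) -> coset_rep g = k.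
Proof.
move=> Hk dk; have [Hr dr] := coset_repP g.
have := @dom_uniq _ (k^-1 * coset_rep g) _ dr.
rewrite -mulgA mulVKg => kr; symmetry; rewrite -[k]invgK; apply: mulg1_eq.
by apply: kr => //; apply: HM => //; apply: HV.
Qed.

Lemma coset_repM k g : H k -> coset_rep (k * g) = k * coset_rep g.
Proof.
move=> Hk; have [Hr dr] := coset_repP g; apply: coset_rep_uniq; first exact: HM.
by rewrite invgM -mulgA mulKg.
Qed.

Lemma coset_rep_dom g : dom g -> coset_rep g = 1.
Proof. by move=> dg; apply: coset_rep_uniq => //; rewrite invg1 mul1g. Qed.

(** One positively oriented representative, with origin in [dom], for each [H]-orbit of tree edges
    joining two different translates of [dom]. *)
Definition basis_edge (s : G * V) : bool :=
  `[< [/\ dom s.1, E s.2 s.1 & coset_rep (s.1 * ev [:: (s.2, true)]) != 1] >].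

Definition basis : choiceType := {s : G * V | basis_edge s}.

Definition basis_elt (s : basis) : G :=
  coset_rep ((val s).1 * ev [:: ((val s).2, true)]).

Local Notation F := (free_group basis).

(** The edge is first translated so that its origin lies in [dom]. Tree edges inside one translate
    of [dom] fail [basis_edge] and receive the trivial symbol. *)
Definition edge_sym g x : F :=
  if insub ((coset_rep g)^-1 * g, x) is Some s then pres_gen _ s else 1.

Lemma edge_sym_act k g x : H k -> edge_sym (k * g) x = edge_sym g x.
Proof. by move=> Hk; rewrite /edge_sym coset_repM // invgM -mulgA mulKg. Qed.

Definition letter_sym g a : F :=
  if a.2 then edge_sym (org g a) a.1 else (edge_sym (org g a) a.1)^-1.

Fixpoint walk_sym g w : F :=
  if w is a :: w' then letter_sym g a * walk_sym (g * ev [:: a]) w' else 1.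

Lemma letter_sym_linv g a :
  letter_sym (g * ev [:: a]) (linv a) = (letter_sym g a)^-1.
Proof. by rewrite /letter_sym org_linv; case: a => x [] //=; rewrite invgK. Qed.

Lemma walk_sym_act k g w : H k -> walk_sym (k * g) w = walk_sym g w.
Proof.
move=> Hk; elim: w g => //= a w IH g; rewrite -mulgA IH; congr (_ * _).
by rewrite /letter_sym orgM edge_sym_act.
Qed.

Lemma walk_sym_cat g u v :
  walk_sym g (u ++ v) = walk_sym g u * walk_sym (g * ev u) v.
Proof.
elim: u g => [|a u IH] g /=; first by rewrite ev_nil mulg1 mul1g.
by rewrite IH (ev_cons e a u) !mulgA.
Qed.

Lemma walk_sym_inv g w : walk_sym (g * ev w) (inv_word w) = (walk_sym g w)^-1.
Proof.
elim: w g => [|a w IH] g /=; first by rewrite invg1.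
rewrite -[a :: w]/([:: a] ++ w) inv_word_cat walk_sym_cat ev_cat (mulgA g) IH.
rewrite ev_inv mulgK invgM; congr (_ * _) => /=.
by rewrite mulg1; apply: letter_sym_linv.
Qed.

Lemma walk_sym_reduce g w : walk_sym g (reduce w) = walk_sym g w.
Proof.
elim: w g => //= a w IH g; rewrite -IH; case: (reduce w) => [|b w'] //=.
case: eqP => [->|//]; rewrite letter_sym_linv mulVKg.
by rewrite ev_linv mulgK.
Qed.

(** The intended inverse on [H] of [free_lift basis_elt]: it records the basis edges, up to [H],
    along the tree path from 1 to [h]. *)
Definition syms h : F := walk_sym 1 (path_to h).

Lemma symsE w : walk (edge E) 1 w -> syms (ev w) = walk_sym 1 w.
Proof.
move=> wE; rewrite /syms -(ev_reduce e w) path_to_uniq ?walk_sym_reduce //.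
  exact: walk_reduce.
exact: reduce_reduced.
Qed.

Lemma symsM h k : H h -> syms (h * k) = syms h * syms k.
Proof.
move=> Hh; have [hE _ hh] := path_toP h; have [kE _ kk] := path_toP k.
have hkE : walk (edge E) 1 (path_to h ++ path_to k).
  rewrite walk_cat hh mul1g; split=> //.
  by rewrite -[h]mulg1 (walk_edge_act sE sH).
have := symsE hkE; rewrite ev_cat hh kk => ->.
by rewrite walk_sym_cat hh mul1g -{2}[h]mulg1 walk_sym_act.
Qed.

(** By [dom_prefix] the whole path stays in [dom], where no edge carries a symbol. *)
Lemma walk_sym_dom w : walk (edge E) 1 w -> reduced w -> dom (ev w) ->
  walk_sym 1 w = 1.
Proof.
elim/last_ind: w => // w a IH wE rw dwa.
have dw := dom_prefix wE rw dwa.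
move: wE rw; rewrite -cats1 walk_sym_cat walk_cat => -[wE _] /reduced_catl rw.
rewrite IH // !mul1g /= mulg1.
have dorg : dom (org (ev w) a) /\ dom (org (ev w) a * ev [:: (a.1, true)]).
  move: dw dwa; rewrite ev_rcons /org; case: (a) => x [] //= dw dwa; split=> //.
  by rewrite (ev_linv e (x, true)) mulgVK.
have -> : letter_sym (ev w) a = if a.2 then 1 else 1^-1; last first.
  by rewrite invg1 if_same.
rewrite /letter_sym; suff -> : edge_sym (org (ev w) a) a.1 = 1 by [].
rewrite /edge_sym; case: insubP => // s /asboolP[_ _] /=.
by rewrite (coset_rep_dom dorg.1) invg1 mul1g (coset_rep_dom dorg.2) eqxx.
Qed.

(** With [k] the basis element, a walk from 1 to [k] runs inside [dom] to the origin of the basis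
    edge, crosses it, and continues inside the translate [k dom]. Only the middle edge has a
    symbol. *)
Lemma syms_basis s : syms (basis_elt s) = pres_gen _ s.
Proof.
case: s => -[d x] sP; rewrite /basis_elt /=; have /asboolP[/= dd Ed _] := sP.
set k := coset_rep _; have [Hk] := coset_repP (d * ev [:: (x, true)]).
rewrite -/k; set d' := k^-1 * _ => dd'.
have [pE rp pd] := path_toP d; have [pE' rp' pd'] := path_toP d'.
pose w := path_to d ++ (x, true) :: inv_word (path_to d').
have dk : d * ev [:: (x, true)] = k * 1 * ev (path_to d').
  by rewrite pd' mulg1 mulVKg.
have wk : ev w = k.
  by rewrite ev_cat ev_cons ev_inv pd mulgA dk mulgK mulg1.
have wE : walk (edge E) 1 w.
  rewrite walk_cat /= pd mul1g; split=> //; split=> //.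
  rewrite dk; apply: walk_inv; first by move=> p a; apply: edge_linv.
  by rewrite (walk_edge_act sE sH).
rewrite -{1}wk symsE // walk_sym_cat /= pd mul1g dk walk_sym_inv.
rewrite walk_sym_act // !walk_sym_dom ?pd ?pd' // invg1 mulg1 mul1g.
rewrite /letter_sym /org /= /edge_sym coset_rep_dom // invg1 mul1g.
by rewrite insubT.
Qed.

(** Telescoping: the symbol of each edge lifts to the quotient of the values of [coset_rep] at its
    two ends, which is 1 when the edge stays in one translate of [dom]. *)
Lemma lift_walk_sym g w : walk (edge E) g w ->
  free_lift basis_elt (walk_sym g w) = (coset_rep g)^-1 * coset_rep (g * ev w).
Proof.
elim: w g => [|a w IH] g /=; first by rewrite free_lift1 ev_nil mulg1 mulVg.
case=> Ea /IH wE; rewrite free_liftM wE (ev_cons e a w) !mulgA; congr (_ * _).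
set t := coset_rep (g * ev [:: a]); rewrite -[RHS](mulgK t); congr (_ * _).
have sym_org p x : E x p -> free_lift basis_elt (edge_sym p x) =
    (coset_rep p)^-1 * coset_rep (p * ev [:: (x, true)]).
  move=> Ex; have [Hp dp] := coset_repP p.
  set c := coset_rep p in Hp dp *.
  have cc : coset_rep (c^-1 * p * ev [:: (x, true)]) =
      c^-1 * coset_rep (p * ev [:: (x, true)]).
    by rewrite -(mulgA c^-1) (coset_repM _ (HV Hp)).
  rewrite /edge_sym -/c; case: insubP => [s _ sE'|].
    by rewrite free_lift_gen /basis_elt sE' /= cc.
  rewrite -cc free_lift1 /basis_edge => /asboolPn /= ncc.
  apply/eqP; rewrite eq_sym; apply: contrapT => /negP cc1.
  by apply: ncc; split=> //; apply: (section_act sE) => //; apply: HV.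
rewrite /letter_sym /t {t wE}; case: a Ea => x [] Ea /=; first exact: sym_org.
rewrite free_liftV sym_org // invgM invgK; congr (_^-1 * _).
by rewrite /org /= (ev_linv e (x, true)) mulgVK.
Qed.

Lemma free_of_section : is_free H.
Proof.
have Hb s : H (basis_elt s) by case: (coset_repP ((val s).1 * ev [:: ((val s).2, true)])).
have Hlift z : H (free_lift basis_elt z).
  elim/free_group_ind: z => [|s z IH|s z IH]; rewrite ?free_lift1 // free_liftM.
    by rewrite free_lift_gen; apply: HM.
  by rewrite free_liftV free_lift_gen; apply/HM/IH/HV.
exists basis, (free_lift basis_elt); split.
- by split; [exact: free_lift1|exact: free_liftM].
- have syms1 : syms 1 = 1 by rewrite /syms -(ev_nil e) path_to_uniq.
  (* [syms] is a left inverse of the lift, by induction on [z]; surjectivity onto [H] will come from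
     [lift_walk_sym]. *)
  apply: (can_inj (g := syms)) => z.
  elim/free_group_ind: z => [|s z IH|s z IH]; rewrite ?free_lift1 // free_liftM.
    by rewrite free_lift_gen symsM // syms_basis IH.
  rewrite free_liftV free_lift_gen symsM ?IH; last exact: HV.
  congr (_ * _); rewrite -(mulg1_eq (y := syms (basis_elt s)^-1) (x := syms (basis_elt s))).
    by rewrite syms_basis.
  by rewrite -symsM // mulgV.
apply/seteqP; split=> h; first by move=> [z _ <-].
move=> Hh; exists (syms h) => //; have [hE _ hh] := path_toP h.
rewrite /syms lift_walk_sym // hh mul1g coset_rep_dom; last exact: dom1.
by rewrite invg1 mul1g -[h]mulg1 coset_repM // coset_rep_dom ?mulg1 //; exact: dom1.
Qed.

End Freeness.

(** * Walls crossed once *)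

Lemma cat_split (T : Type) (u v s t : seq T) : u ++ s = v ++ t ->
  (size u <= size v)%N -> exists m, v = u ++ m /\ s = m ++ t.
Proof.
elim: u v => [|a u IH] [|b v] //= => [->|->|]; [by exists [::]|by exists (b :: v)|].
by case=> -> /IH{}IH /IH[m [-> ->]]; exists m.
Qed.

Lemma uniform_bound (T : eqType) (l : seq T) (P : T -> nat -> Prop) :
  (forall t m n, P t m -> P t n -> m = n) ->
  exists N, forall t n, t \in l -> P t n -> (n <= N)%N.
Proof.
move=> Puniq; elim: l => [|t l [N IH]]; first by exists 0%N.
have [[n Pn]|nP] := pselect (exists n, P t n).
  exists (maxn n N) => t' m; rewrite inE => /predU1P[->|/IH{}IH /IH].
    by move=> /(Puniq _ _ _ Pn) <-; rewrite leq_maxl.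
  by move=> mN; rewrite leq_max mN orbT.
exists N => t' m; rewrite inE => /predU1P[-> Pm|]; last exact: IH.
by case: nP; exists m.
Qed.

Lemma leq_of_inj_rel (R : nat -> nat -> Prop) m n :
  (forall i, (i < m)%N -> exists2 j, (j < n)%N & R i j) ->
  (forall i i' j, (i < m)%N -> (i' < m)%N -> R i j -> R i' j -> i = i') ->
  (m <= n)%N.
Proof.
move=> tot inj; have /choice[f fP] (i : 'I_m) : exists j : 'I_n, R i j.
  by have [j jn Rij] := tot i (ltn_ord i); exists (Ordinal jn).
rewrite -[m]card_ord -[n]card_ord; apply: (@leq_card _ _ f) => i i' ff.
by apply: ord_inj; apply: (inj _ _ (f i)) => //; rewrite ff.
Qed.

Section Undistorted.
Variables (V : finType) (e : rel V) (H : set (raag e)) (r : V -> nat).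
Local Notation G := (raag e).
Local Notation letter := (V * bool)%type.
Local Notation ev := (@ev V e).
Implicit Types (u v w : word V) (a : letter) (x y : V) (g h k p q d : G) (D : seq G).
Variable E : V -> set G.
Hypotheses (sE : equivariant_section H r E) (sH : subgroup H).
Hypotheses (sg : simple_graph e) (r_inj : injective r) (sfH : star_free H).

(** An element stabilizing a wall is conjugate into [A(link x)], hence into a star subgroup. *)
Lemma wall_free x p k : H k -> same_wall x p (k * p) -> k = 1.
Proof.
move=> Hk pk; apply: (sfH (h := k) (v := x) (g := p) Hk).
apply: raag_subS pk.
by apply/fintype.subsetP => y; rewrite !finset.inE orbC => ->.
Qed.

(* Only finitely many pairs of H-orbits of edges occur, and for each of them at
   most one relative position makes the two edges cross the same hyperplane. *)
Lemma wall_bound D : exists N, forall g x (b c : bool) m,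
  walk (edge_in H E D) g ((x, b) :: rcons m (x, c)) ->
  reduced ((x, b) :: rcons m (x, c)) ->
  same_wall x (org g (x, b)) (org (g * ev ((x, b) :: m)) (x, c)) ->
  (size m <= N)%N.
Proof.
(* A tuple records orbit representatives of the starting vertices of the two edges, the first letter
   and the sign of the second; [h] is their relative position. *)
pose P (t : G * G * letter * bool) n :=
  let: (d, d', (x, b), c) := t in exists h m, [/\ H h,
    walk (edge E) d ((x, b) :: m), reduced ((x, b) :: m),
    d * ev ((x, b) :: m) = h * d' &
    same_wall x (org d (x, b)) (org (h * d') (x, c)) /\ size m = n].
have [] := @uniform_bound _ [seq (z, c) | z <- [seq (z, a) | z <-
    [seq (d, d') | d <- D, d' <- D], a <- enum {: letter}], c <- enum {: bool}] P.
  move=> [[[d d'] [x b]] c] n1 n2 [h1 [m1 [Hh1 wm1 rm1 E1 [sw1 <-]]]].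
  move=> [h2 [m2 [Hh2 wm2 rm2 E2 [sw2 <-]]]].
  (* Both translates of the second edge cross the wall of the first, so [wall_free] applies; the two
     walks then have the same ends and are equal. *)
  have h12 : h2 * h1^-1 = 1.
    apply: (@wall_free x (org (h1 * d') (x, c))).
      by apply: subgroupM => //; apply: subgroupV.
    rewrite -orgM mulgA mulgVK.
    exact: same_wall_trans (same_wall_sym sw1) sw2.
  have [-> //] : (x, b) :: m1 = (x, b) :: m2.
  apply: (walk_uniq sE sg r_inj wm1) => //; apply: (@mulgI _ d).
  by rewrite E1 E2 (divg1_eq h12).
move=> N NP; exists N => g x b c m wE red sw.
rewrite -cats1 -cat_cons in wE red; have [w1 [w2 _]] := (walk_cat _ _ _ _).1 wE.
have [k Hk kg] : orbits H D g by case: w1 => -[].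
have [k' Hk' kg'] : orbits H D (g * ev ((x, b) :: m)) by case: w2.
apply: (NP (k * g, k' * (g * ev ((x, b) :: m)), (x, b), c)).
  by do 2![apply: allpairs_f; last by rewrite mem_enum]; apply: allpairs_f.
exists (k * k'^-1), m.
have kE : k * k'^-1 * (k' * (g * ev ((x, b) :: m))) = k * (g * ev ((x, b) :: m)).
  by rewrite mulgA mulgVK.
split; rewrite ?kE ?mulgA //.
- by apply: subgroupM => //; apply: subgroupV.
- by apply: walk_trans w1 => p a [Ea _ _]; rewrite (edge_act sE sH).
- exact: reduced_catl red.
- by split=> //; rewrite -(mulgA k) 2!(orgM k); apply/same_wallM.
Qed.

Definition crosses x q g w i : Prop := exists u (b : bool) v,
  [/\ w = u ++ (x, b) :: v, size u = i & same_wall x q (org (g * ev u) (x, b))].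

Definition crosses_once x q g w i : Prop :=
  crosses x q g w i /\ forall j, crosses x q g w j -> j = i.

(** Combined with [parity_eq], this forces every word with the same value to cross that wall. *)
Lemma crosses_once_parity x q g w i :
  crosses_once x q g w i -> parity x q g w = true.
Proof.
case=> -[u [b [v [wE <- qu]]]] uniq_i; rewrite wE parity_cat /= eqxx asboolT //=.
have [/parityP[u1 [c [u2 [uE qc]]]]|_] := boolP (parity _ _ _ u).
  have : size u1 = size u.
    by apply: uniq_i; exists u1, c, (u2 ++ (x, b) :: v); rewrite wE uE -catA.
  by rewrite uE size_cat /=; lia.
have [/parityP[v1 [c [v2 [vE qc]]]]|//] := boolP (parity _ _ _ v).
have : size (u ++ (x, b) :: v1) = size u.
  apply: uniq_i; exists (u ++ (x, b) :: v1), c, v2; split=> //.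
    by rewrite wE vE -catA.
  by rewrite ev_cat ev_cons !mulgA.
by rewrite size_cat /=; lia.
Qed.

(** Induction on the rank bound. Long enough margins are cut off both ends of the segment. If the
    rest has no letter of top rank, recurse on it. Otherwise take such a letter: by [wall_bound] any
    other crossing of its wall is so near that the letters in between lie in the segment,
    contradicting [recross]. *)
Lemma crosses_once_exists D : exists N, forall n g w pre mid post,
  walk (edge_in H E D) g w -> reduced w -> w = pre ++ mid ++ post ->
  all (fun a => r a.1 < n)%N mid -> (n * N < size mid)%N ->
  exists i x q, (size pre <= i < size pre + size mid)%N /\ crosses_once x q g w i.
Proof.
(* Each rank costs a margin of [N.+1] letters at either end. *)
have [N NP] := wall_bound D; exists (N.+1 + N.+1)%N.
elim=> [|n IH] g w pre s post wD rw wE sn ssz.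
  by case: s sn ssz {wE}.
pose s1 := take N.+1 s; pose s2 := drop (size s - N.+1) s.
pose mid := take (size s - N.+1 - N.+1) (drop N.+1 s).
have sE3 : s = s1 ++ mid ++ s2.
  rewrite -[LHS](cat_take_drop N.+1); congr (_ ++ _).
  rewrite -[LHS](cat_take_drop (size s - N.+1 - N.+1)); congr (_ ++ _).
  by rewrite drop_drop; congr (drop _ _); nia.
have z1 : size s1 = N.+1 by rewrite size_takel //; nia.
have z2 : size s2 = N.+1 by rewrite size_drop; nia.
have zs : size s = (N.+1 + (size mid + N.+1))%N by rewrite {1}sE3 !size_cat z1 z2.
have [/hasP[[x b] xmid /= nx]|] := boolP (has (fun a => n <= r a.1)%N mid); last first.
  rewrite -all_predC => midn.
  have [|||i [x [q [iP cross1]]]] := IH g w (pre ++ s1) mid (s2 ++ post) wD rw.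
  - by rewrite wE sE3 -!catA.
  - by apply: sub_all midn => a /=; rewrite -ltnNge.
  - by nia.
  by exists i, x, q; split=> //; move: iP; rewrite size_cat; lia.
have sx a : a \in s -> (r a.1 <= r x)%N.
  by move=> /(allP sn); rewrite ltnS => /leq_trans; apply.
case/splitPr: xmid (sE3) zs => m1 m2 {}sE3 zs; move: zs; rewrite size_cat /= => zs.
pose u := pre ++ s1 ++ m1; pose v := m2 ++ s2 ++ post.
have wE' : w = u ++ (x, b) :: v by rewrite wE sE3 /u /v -!catA.
exists (size u), x, (org (g * ev u) (x, b)); split.
  by rewrite /u !size_cat; lia.
split=> [|j [u' [c [v' [wE2 <- cu']]]]].
  by exists u, b, v; split=> //; apply: same_wall_refl.
apply/eqP; case: ltngtP => // lt_u; exfalso.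
- have [l [uE lE]] : exists l, u = u' ++ l /\ (x, c) :: v' = l ++ (x, b) :: v.
    by apply: cat_split (ltnW lt_u); rewrite -wE2.
  case: l uE lE => [|a u2] uE; first by move: lt_u; rewrite uE cats0 ltnn.
  case=> aE _; rewrite -{a}aE in uE.
  have wsub : w = u' ++ ((x, c) :: rcons u2 (x, b)) ++ v.
    by rewrite wE' uE -catA /= cat_rcons.
  have := wD; rewrite wsub walk_cat => -[_ /walk_cat[wD2 _]].
  have rw2 : reduced ((x, c) :: rcons u2 (x, b)).
    by move: rw; rewrite wsub => /reduced_catr/reduced_catl.
  have sw : same_wall x (org (g * ev u') (x, c))
      (org (g * ev u' * ev ((x, c) :: u2)) (x, b)).
    by apply: same_wall_sym; move: cu'; rewrite uE ev_cat !mulgA.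
  have u2N := NP _ _ _ _ _ wD2 rw2 sw.
  have [l [_ lE]] : exists l, rcons u' (x, c) = pre ++ l /\ s1 ++ m1 = l ++ u2.
    apply: cat_split; first by rewrite cat_rcons -uE.
    move: (congr1 size uE); rewrite /u !size_cat size_rcons /= z1; lia.
  apply: (recross sE sg r_inj (walk_sub _ wD2) rw2 _ sw); first by move=> p a [].
  apply/allP => a au2; apply: sx.
  by rewrite sE3 -catA catA mem_cat lE mem_cat au2 orbT.
- have [l [uE lE]] : exists l, u' = u ++ l /\ (x, b) :: v = l ++ (x, c) :: v'.
    by apply: cat_split (ltnW lt_u); rewrite -wE2.
  case: l uE lE => [|a v1] uE; first by move: lt_u; rewrite uE cats0 ltnn.
  case=> aE vE; rewrite -{a}aE in uE.
  have wsub : w = u ++ ((x, b) :: rcons v1 (x, c)) ++ v'.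
    by rewrite wE' vE /= cat_rcons.
  have := wD; rewrite wsub walk_cat => -[_ /walk_cat[wD2 _]].
  have rw2 : reduced ((x, b) :: rcons v1 (x, c)).
    by move: rw; rewrite wsub => /reduced_catr/reduced_catl.
  have sw : same_wall x (org (g * ev u) (x, b))
      (org (g * ev u * ev ((x, b) :: v1)) (x, c)).
    by move: cu'; rewrite uE ev_cat !mulgA.
  have v1N := NP _ _ _ _ _ wD2 rw2 sw.
  have [l [lE _]] : exists l, m2 ++ s2 = v1 ++ l /\ (x, c) :: v' = l ++ post.
    apply: cat_split; first by rewrite -vE /v -catA.
    by rewrite size_cat z2; lia.
  apply: (recross sE sg r_inj (walk_sub _ wD2) rw2 _ sw); first by move=> p a [].
  apply/allP => a av1; apply: sx; rewrite sE3 !mem_cat inE.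
  have : a \in m2 ++ s2 by rewrite lE mem_cat av1.
  by rewrite mem_cat => /orP[]->; rewrite !orbT.
Qed.

(** Cut [w] into blocks of [B] letters. Each contains an edge whose wall [w] crosses only once, so
    [w'] crosses that wall too, and distinct blocks use distinct letters of [w']. *)
Lemma path_length : fin_gen H -> exists C, forall w w',
  H (ev w) -> walk (edge E) 1 w -> reduced w -> ev w' = ev w ->
  (size w <= C * (size w').+1)%N.
Proof.
move=> /(cofinite sE sH sg r_inj)[D DP]; have [N NP] := crosses_once_exists D.
pose n := (\max_(x : V) r x).+1; pose B := (n * N).+1.
exists B => w w' Hw wE rw ww'; have wD := DP w Hw wE rw.
suff : (size w %/ B <= size w')%N.
  by move=> kw; apply: ltnW; rewrite mulnC -ltn_divLR //.
have block i : (i < size w %/ B)%N -> exists j x q,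
    (i * B <= j < i.+1 * B)%N /\ crosses_once x q 1 w j.
  move=> ik; have iB : (i.+1 * B <= size w)%N.
    by apply: leq_trans (leq_trunc_div _ B); rewrite leq_mul2r ik orbT.
  have zpre : size (take (i * B) w) = (i * B)%N.
    by rewrite size_takel //; apply: leq_trans iB; rewrite leq_mul2r leqnSn orbT.
  have zmid : size (take B (drop (i * B) w)) = B.
    by rewrite size_takel // size_drop; rewrite mulSn in iB; lia.
  have [|||j [x [q [jP once]]]] := NP n 1 w (take (i * B) w)
      (take B (drop (i * B) w)) (drop B (drop (i * B) w)) wD rw.
  - by rewrite !cat_take_drop.
  - by apply/allP => a _; rewrite ltnS; apply: leq_bigmax.
  - by rewrite zmid.
  by exists j, x, q; move: jP; rewrite zpre zmid mulSn addnC.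
pose R i j := exists x q i', [/\ (i * B <= i' < i.+1 * B)%N,
  crosses_once x q 1 w i' & crosses x q 1 w' j].
apply: (@leq_of_inj_rel R) => [i /block[i' [x [q [iP once]]]]|].
  have : parity x q 1 w'.
    by rewrite (@parity_eq _ _ _ _ _ _ w sg) ?(crosses_once_parity once) //; apply/pres_classP.
  case/parityP=> u [b [v [w'E qu]]]; exists (size u).
    by rewrite w'E size_cat /=; lia.
  by exists x, q, i'; split=> //; exists u, b, v.
(* A letter of [w'] crosses a single wall, and that wall is crossed by [w] at a single position,
   which lies in a single block. *)
move=> i1 i2 j _ _ [x1 [q1 [k1 [k1P once1 [u1 [b1 [v1 [E1 z1 s1]]]]]]]].
move=> [x2 [q2 [k2 [k2P [[u [b [v [wuv zu su]]]] _] [u2 [b2 [v2 [E2 z2 s2]]]]]]]].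
have [uu] : u1 = u2 /\ (x1, b1) :: v1 = (x2, b2) :: v2.
  by move/eqP: E1; rewrite E2 eq_sym eqseq_cat ?z1 ?z2 // => /andP[/eqP ? /eqP ?].
case=> xx bb _; subst x2 b2 u2.
have k12 : k2 = k1.
  apply: once1.2; exists u, b, v; split=> //.
  exact: same_wall_trans s1 (same_wall_trans (same_wall_sym s2) su).
by subst k2; nia.
Qed.

End Undistorted.

(** * The main theorem *)

Section Rank.
Variables (V : finType) (L : {set V}).

(** Vertices of [L] come first, so that [A(L)] is the subgroup of ranks below [#|V|]. *)
Definition rank_of (x : V) : nat :=
  if x \in L then nat_of_ord (enum_rank x) else (#|V| + enum_rank x)%N.

Lemma rank_of_inj : injective rank_of.
Proof.
move=> x y xy; apply/enum_rank_inj/ord_inj; move: xy; rewrite /rank_of.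
have : (enum_rank x < #|V|)%N := ltn_ord _.
have : (enum_rank y < #|V|)%N := ltn_ord _.
move: (nat_of_ord (enum_rank x)) (nat_of_ord (enum_rank y)) => i j.
by case: ifP => _; case: ifP => _; lia.
Qed.

Lemma rank_of_low : [set y | rank_of y < #|V|]%SET = L.
Proof.
apply/setP => y; rewrite finset.inE /rank_of; case: ifP => _; first exact: ltn_ord.
by rewrite -ltn_subRL subnn.
Qed.

End Rank.

(** * Freeness, finite generation and length comparison for star-free subgroups *)

Section StarFree.
Variables (V : finType) (e : rel V) (H : set (raag e)).
Hypotheses (sg : simple_graph e) (sH : subgroup H) (sfH : star_free H).
Hypothesis fgH : fin_gen H.
Local Notation G := (raag e).

Lemma star_free_free : is_free H.
Proof.
have rI := @rank_of_inj V [set: V]%SET.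
have [E sE] := equivariant_section_exists (rank_of [set: V]%SET) sH sfH.
exact: (free_of_section sE sH sg rI).
Qed.

Lemma star_free_fin_gen (L : {set V}) : fin_gen (H `&` raag_sub L).
Proof.
have rI := @rank_of_inj V L.
have [E sE] := equivariant_section_exists (rank_of L) sH sfH.
have [s [sK Ks]] := low_generators sE sH sg rI #|V| fgH.
rewrite rank_of_low in sK Ks; exists s; apply/seteqP; split.
  apply: gen_subgroup_sub; first by apply: subgroupI => //; apply: raag_sub_subgroup.
  by move=> z; apply: sK.
move=> h Kh; have [w [wE rw]] := path_exists sE 1 h; rewrite mul1g => wh.
apply/gen_subgroupP; exists (size w).+1; rewrite -wh.
by apply: Ks => //; rewrite wh.
Qed.

(** The nontrivial bound passes from [s] to the standard generators ([c1]), to the tree path ([c4]),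
    to the generators [q] read along that path, and to [t] ([c3]). The other bound is a change of
    generators ([c2]). *)
Lemma star_free_word_length s t : generates s [set: G] -> generates t H ->
  exists A, forall k, H k ->
    (word_length t k <= A * (word_length s k).+1)%N /\
    (word_length s k <= A * word_length t k)%N.
Proof.
move=> sG tH; have rI := @rank_of_inj V [set: V]%SET.
have [E sE] := equivariant_section_exists (rank_of [set: V]%SET) sH sfH.
have sP g : exists n, expressible s g n.
  by apply/gen_subgroupP; rewrite -/(generates _ _) sG.
have tP g : H g -> exists n, expressible t g n.
  by move=> Hg; apply/gen_subgroupP; rewrite tH.
pose gV : seq G := [seq ev e [:: (x, true)] | x <- enum V].
have gVP g n : expressible gV g n -> exists2 w, size w = n & ev e w = g.
  case=> l [<- lV <-] {g n}; elim: l lV => [|z l IH] /=.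
    by exists [::]; rewrite ?big_nil.
  case/andP=> zV /IH[w <- wl]; rewrite big_cons.
  have [a az] : exists a, ev e [:: a] = z.
    case/orP: zV => /mapP[x _ zx]; first by exists (x, true).
    by exists (x, false); rewrite (ev_linv e (x, true)) -zx invgK.
  by exists (a :: w) => //; rewrite ev_cons az wl.
have gV_s z : z \in s -> exists n, expressible gV z n.
  move=> _; have [w ->] := ev_surj z; exists (size w).
  elim: w => [|[x b] w IH]; first exact: expressible1.
  rewrite ev_cons /= -add1n; apply: expressibleM => //.
  have xV : expressible gV (ev e [:: (x, true)]) 1.
    by apply: expressible_mem; apply: map_f; rewrite mem_enum.
  by case: b => //; rewrite (ev_linv e (x, true)); apply: expressibleV.
have [c1 sVc] := expressible_trans gV_s.
have [c2 tsc] := expressible_trans (s := s) (t := t) (fun z _ => sP z).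
have [q [qK Kq]] := low_generators sE sH sg rI #|V| fgH.
rewrite rank_of_low in qK Kq.
have [c3 qtc] := expressible_trans (fun z zq => tP z (qK z zq).1).
have [c4 pathc] := path_length sE sH sg rI sfH fgH.
exists (c3 * (c4 * c1.+1).+1 + c2)%N => k Hk.
have [sk smin] := word_lengthP (sP k); have [tk tmin] := word_lengthP (tP k Hk).
set ns := word_length s k in sk smin *; set nt := word_length t k in tk tmin *.
split; last first.
  have [m mc sm] := tsc _ _ tk; have := smin _ sm; nia.
have [m mc /gVP[w' w'm w'k]] := sVc _ _ sk.
have [w [wE rw]] := path_exists sE 1 k; rewrite mul1g => wk.
have wc : (size w <= c4 * (size w').+1)%N by apply: pathc; rewrite ?wk.
have := Kq w; rewrite wk => /(_ _ wE rw)[|l qw].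
  split=> //; rewrite -wk; apply/raag_subP; exists w => //.
  by apply/allP => a _; rewrite finset.inE.
have [n nc tn] := qtc _ _ (ex_intro _ l qw); have := tmin _ tn.
rewrite w'm in wc.
move=> ntn; apply: (leq_trans ntn); apply: (leq_trans nc).
rewrite mulnDl; apply: leq_trans (leq_addr _ _); rewrite -mulnA leq_mul2l.
apply/orP; right.
nia.
Qed.

End StarFree.

(** * From bounds in natural numbers to quasi-isometry constants *)

Section RealConstants.
Import GRing.Theory Num.Theory.
Local Open Scope ring_scope.

Lemma undistorted_of_word_length (R : realType) (G : groupType) (H : set G) :
  subgroup H ->
  (forall s t, generates s [set: G] -> generates t H ->
    exists A, forall k, H k ->
      (word_length t k <= A * (word_length s k).+1)%N /\
      (word_length s k <= A * word_length t k)%N) ->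
  undistorted R H.
Proof.
move=> sH wl s t sG tH; have [A AP] := wl s t sG tH.
(* [A.+1] ensures a multiplicative constant at least 1 even when [A] is 0; the additive constant 1
   absorbs the successor in the first length bound. *)
exists A.+1%:R, 1; split; rewrite ?ler01 ?ler1n //.
move=> g h Hg Hh; have [] := AP (g^-1 * h)%g.
  by apply: subgroupM => //; apply: subgroupV.
rewrite /word_dist; set ns := word_length s _; set nt := word_length t _ => h1 h2.
split.
  rewrite lerBlDr mulrC ler_pdivrMr ?ltr0n // -[1]/(1%:R) -natrD -natrM ler_nat.
  by nia.
by rewrite -[1]/(1%:R) -natrM -natrD ler_nat; nia.
Qed.

End RealConstants.

Unset Implicit Arguments.

Theorem theorem1p2 (R : realType) (V : finType) (e : rel V) (H : set (raag e)) :
  simple_graph e -> connected_graph e -> connected_graph (opposite e) ->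
  subgroup H -> fin_gen H -> star_free H ->
  [/\ is_free H,
      undistorted R H &
      forall L : {set V}, fin_gen (H `&` raag_sub L)].
Proof.
move=> sg _ _ sH fgH sfH; split.
- exact: star_free_free.
- apply: undistorted_of_word_length => // s t; exact: star_free_word_length.
- by move=> L; apply: star_free_fin_gen.
Qed.
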